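(* Let $\mathcal{X}$ and $\mathcal{Z}$ be Euclidean spaces. Let $\mathfrak{S}:\mathcal{X}\to\mathcal{Z}$ be a differentiable mapping such that $\mathfrak{S}$ and its G\^ateaux derivative $\mathrm{D}\mathfrak{S}$ are Lipschitz continuous; let $g:\mathcal{Z}\to\mathbb{R}$ be Lipschitz continuous and $\eta$-weakly convex for some $\eta>0$; let $C\subset\mathcal{X}$ be a nonempty closed prox-regular set; set $F:=g\circ\mathfrak{S}$ and assume $\mathop{\mathrm{argmin}}_{x\in C}F(x)\neq\emptyset$. Choose $x_1\in C$, $c\in(0,1/2)$, $\rho\in(0,1)$, $\tilde\gamma>0$ and $\alpha\ge1$, and let $(x_n)_{n\ge1}\subset C$ and $(\gamma_n)_{n\ge1}$ be generated by the following projected variable smoothing algorithm: for $n=1,2,\dots$, set $\mu_n:=(2\eta)^{-1}n^{-1/\alpha}$ and $F_n:={}^{\mu_n}g\circ\mathfrak{S}$; then for $m=0,1,2,\dots$, pick some $x\in P_C\big(x_n-\rho^m\tilde\gamma\nabla F_n(x_n)\big)$, and if $F_n(x)\le F_n(x_n)-c\rho^m\tilde\gamma\big\|\frac{x_n-x}{\rho^m\tilde\gamma}\big\|^2$ holds, set $x_{n+1}:=x$, $\gamma_n:=\rho^m\tilde\gamma$ and stop the inner loop. Then: (a) $\liminf_{n\to\infty}\mathcal{M}_{\gamma_n}^{F_n,\iota_C}(x_n)=0$; (b) for any subsequence $(x_{m(l)})_{l\ge1}$ of $(x_n)$, with $m:\mathbb{N}\to\mathbb{N}$ monotonically increasing,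 such that $\lim_{l\to\infty}\mathcal{M}_{\gamma_{m(l)}}^{F_{m(l)},\iota_C}(x_{m(l)})=0$, every cluster point $x^\star\in C$ of $(x_{m(l)})_{l\ge1}$ satisfies $0\in\partial_F(F+\iota_C)(x^\star)$, i.e. is a stationary point of minimizing $F$ over $C$.
   Context: Prox-regularity of $C$: the metric projection $P_C(\bar x):=\mathop{\mathrm{argmin}}_{x\in C}\|\bar x-x\|$ (nonempty for every $\bar x$ since $C$ is closed) is single-valued on some open subset of $\mathcal{X}$ containing $C$. $\iota_C$ is the indicator function of $C$ ($0$ on $C$, $+\infty$ elsewhere). For a proper $J:\mathcal{X}\to\mathbb{R}\cup\{+\infty\}$, the Fr\'echet subdifferential $\partial_F J(\bar x)$ at $\bar x\in\mathrm{dom}\,J$ is the set of $v$ with $\sup_{\epsilon>0}\inf_{0<\|x-\bar x\|<\epsilon}\frac{J(x)-J(\bar x)-\langle v,x-\bar x\rangle}{\|x-\bar x\|}\ge0$ (empty if $\bar x\notin\mathrm{dom}\,J$); for continuously differentiable $J$ it equals $\{\nabla J(\bar x)\}$. For $\mu\in(0,\eta^{-1})$, $\mathrm{prox}_{\mu g}(\bar z):=\mathop{\mathrm{argmin}}_{z\in\mathcal{Z}}\big(g(z)+\frac{1}{2\mu}\|z-\bar z\|^2\big)$ is single-valued and the Moreau envelope ${}^{\mu}g(\bar z):=g(\mathrm{prox}_{\mu g}(\bar z))+\frac{1}{2\mu}\|\mathrm{prox}_{\mu g}(\bar z)-\bar z\|^2$ is continuously differentiable with $\nabla{}^{\mu}g(\bar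 z)=\mu^{-1}(\bar z-\mathrm{prox}_{\mu g}(\bar z))$. For a function $J:\mathcal{X}\to\mathbb{R}$, $\gamma>0$ and $\bar x\in\mathcal{X}$, $\mathcal{M}_{\gamma}^{J,\iota_C}(\bar x):=\mathrm{dist}\big(0,\{(\bar x-p)/\gamma : p\in P_C(\bar x-\gamma v),\ v\in\partial_F J(\bar x)\}\big)$, with $\mathrm{dist}(0,S)=\inf_{s\in S}\|s\|$. *)

(* Defs.v *)
(* Euclidean spaces are modelled as 'rV[R]_n with the
   standard inner product (every Euclidean space is isometric to some R^n). *)
From HB Require Import structures.
From mathcomp Require Import all_boot all_order all_algebra.
From mathcomp Require Import all_classical all_reals all_analysis.
Set Implicit Arguments. Unset Strict Implicit. Unset Printing Implicit Defensive.
Import Order.TTheory GRing.Theory Num.Theory.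
Import numFieldNormedType.Exports.
Local Open Scope classical_set_scope.
Local Open Scope ring_scope.

Section Defs.
Variable R : realType.

Definition dotv n (u v : 'rV[R]_n) : R := \sum_(i < n) u ord0 i * v ord0 i.
Definition enorm n (u : 'rV[R]_n) : R := Num.sqrt (dotv u u).

Definition elipschitz n k (f : 'rV[R]_n -> 'rV[R]_k) :=
  exists L : R, forall x y, enorm (f x - f y) <= L * enorm (x - y).
Definition elipschitz_real n (f : 'rV[R]_n -> R) :=
  exists L : R, forall x y, `|f x - f y| <= L * enorm (x - y).

(* the (Gateaux = Frechet) derivative DS x : v |-> 'd S x v is Lipschitz in x,
   w.r.t. the operator norm (written out) *)
Definition deriv_lipschitz n k (S : 'rV[R]_n -> 'rV[R]_k) :=
  exists L : R, forall x y v,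
    enorm ('d S x v - 'd S y v) <= L * enorm (x - y) * enorm v.

Definition convex_fun n (h : 'rV[R]_n -> R) :=
  forall x y (t : R), 0 <= t <= 1 ->
    h (t *: x + (1 - t) *: y) <= t * h x + (1 - t) * h y.

Definition weakly_convex n (eta : R) (g : 'rV[R]_n -> R) :=
  convex_fun (fun z => g z + eta / 2 * enorm z ^+ 2).

Definition in_proj n (C : set 'rV[R]_n) (xb p : 'rV[R]_n) :=
  C p /\ forall x, C x -> enorm (xb - p) <= enorm (xb - x).

Definition prox_regular n (C : set 'rV[R]_n) :=
  exists U : set 'rV[R]_n, open U /\ C `<=` U /\
    forall xb p q, U xb -> in_proj C xb p -> in_proj C xb q -> p = q.

Definition moreau n (mu : R) (g : 'rV[R]_n -> R) (zb : 'rV[R]_n) : R :=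
  inf [set g z + (2 * mu)^-1 * enorm (z - zb) ^+ 2 | z in [set: 'rV[R]_n]].

Definition grad n (f : 'rV[R]_n -> R) (x : 'rV[R]_n) : 'rV[R]_n :=
  \row_(i < n) ('d f x (delta_mx ord0 i : 'rV[R]_n) : R).

Definition iotaC n (C : set 'rV[R]_n) (x : 'rV[R]_n) : \bar R :=
  if `[< C x >] then 0%E else +oo%E.

(* Frechet subdifferential: v \in d_F J(xb), with the liminf condition
   sup_{e>0} inf_{0<||x-xb||<e} (J x - J xb - <v,x-xb>)/||x-xb|| >= 0 written out *)
Definition frechet_subdiff n (J : 'rV[R]_n -> \bar R) (xb v : 'rV[R]_n) :=
  J xb \is a fin_num /\
  forall d : R, 0 < d -> exists e : R, 0 < e /\
    forall x, 0 < enorm (x - xb) < e ->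
      ((- d * enorm (x - xb))%:E <= J x - J xb - (dotv v (x - xb))%:E)%E.

Definition Mstat n (gamma : R) (J : 'rV[R]_n -> \bar R) (C : set 'rV[R]_n)
    (xb : 'rV[R]_n) : \bar R :=
  ereal_inf [set (enorm (gamma^-1 *: (xb - p)))%:E |
     p in [set p | exists v, frechet_subdiff J xb v /\
                             in_proj C (xb - gamma *: v) p]].

End Defs.

(* Main.v *)
(* The smoothed objective [Fn = moreau mu g \o S] agrees with its linearization
   up to a quadratic error of size [O(1/mu)], because an envelope is bounded
   above by any quadratic through a proximal point, and the proximal map is
   Lipschitz.  Backtracking therefore stops at a step [gam j >= kappa * mu j].
   The quantity [Fn j (x j) + 4 L^2 mu j] decreases by [c * gam j] times the
   squared stationarity measure, and the sum of the [mu j] diverges as the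
   harmonic series, which gives (a).

   For (b), single-valuedness of the projection on an open set has to be turned
   into a uniform inequality [<w, y - a> <= |w| / (2 r) |y - a|^2] for proximal
   normals [w] at [a].  Maximizing the distance to [C] over a small ball around
   a point projecting to [a] shows that the point can be pushed away from [a]
   along the normal without changing its projection; doubling repeatedly
   reaches the radius [r].  The inequality and the weak convexity of [g] then
   give [g (S y) >= g (S xs) - K |y - xs|^2] for all [y] in [C], by comparing with
   a single iterate chosen close enough to [xs] in terms of [|y - xs|]. *)
Require Import Defs.
From HB Require Import structures.
From mathcomp Require Import all_boot all_order all_algebra.
From mathcomp Require Import all_classical all_reals all_analysis.
From mathcomp Require Import ring lra.
Import Order.TTheory GRing.Theory Num.Theory.
Import numFieldNormedType.Exports.
Local Open Scope classical_set_scope.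
Local Open Scope ring_scope.
Set Implicit Arguments.
Unset Strict Implicit.
Unset Printing Implicit Defensive.

(** * Inner product and Euclidean norm, compared with the maximum norm of row vectors *)

Section Euclid.
Variables (R : realType) (n : nat).
Implicit Types (u v w x y : 'rV[R]_n) (a : R).

Lemma dotvC u v : dotv u v = dotv v u.
Proof. by apply: eq_bigr => i _; rewrite mulrC. Qed.

Lemma dotvDl u v w : dotv (u + v) w = dotv u w + dotv v w.
Proof. by rewrite -big_split; apply: eq_bigr => i _; rewrite mxE mulrDl. Qed.

Lemma dotvZl a u v : dotv (a *: u) v = a * dotv u v.
Proof. by rewrite mulr_sumr; apply: eq_bigr => i _; rewrite mxE mulrA. Qed.

Lemma dotvNl u v : dotv (- u) v = - dotv u v.
Proof. by rewrite -scaleN1r dotvZl mulN1r. Qed.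

Lemma dotvBl u v w : dotv (u - v) w = dotv u w - dotv v w.
Proof. by rewrite dotvDl dotvNl. Qed.

Lemma dotvDr u v w : dotv w (u + v) = dotv w u + dotv w v.
Proof. by rewrite !(dotvC w) dotvDl. Qed.

Lemma dotvZr a u v : dotv u (a *: v) = a * dotv u v.
Proof. by rewrite !(dotvC u) dotvZl. Qed.

Lemma dotvNr u v : dotv u (- v) = - dotv u v.
Proof. by rewrite !(dotvC u) dotvNl. Qed.

Lemma dotvBr u v w : dotv w (u - v) = dotv w u - dotv w v.
Proof. by rewrite !(dotvC w) dotvBl. Qed.

Definition dotvE := (dotvDl, dotvDr, dotvNl, dotvNr, dotvZl, dotvZr).

Lemma dotv0l u : dotv 0 u = 0.
Proof. by rewrite -(scale0r 0) dotvZl mul0r. Qed.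

Lemma dotvv_ge0 u : 0 <= dotv u u.
Proof. by apply: sumr_ge0 => i _; rewrite -expr2 sqr_ge0. Qed.

Lemma enorm_ge0 u : 0 <= enorm u.
Proof. exact: sqrtr_ge0. Qed.

Lemma enorm_sqr u : enorm u ^+ 2 = dotv u u.
Proof. by rewrite sqr_sqrtr // dotvv_ge0. Qed.

Lemma dotvv_eq0 u : dotv u u = 0 -> u = 0.
Proof.
move=> /eqP; rewrite psumr_eq0; last by move=> i _; rewrite -expr2 sqr_ge0.
move=> /allP h; apply/rowP => i; rewrite mxE.
by have := h i (mem_index_enum i); rewrite /= mulf_eq0 orbb => /eqP.
Qed.

Lemma enorm0 : enorm (0 : 'rV[R]_n) = 0.
Proof. by rewrite /enorm dotv0l sqrtr0. Qed.

Lemma enorm_eq0 u : enorm u = 0 -> u = 0.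
Proof. by move=> h; apply: dotvv_eq0; rewrite -enorm_sqr h expr0n. Qed.

Lemma enorm_gt0 u : u != 0 -> 0 < enorm u.
Proof.
by rewrite lt_def enorm_ge0 andbT; apply: contra => /eqP/enorm_eq0 ->.
Qed.

Lemma enormZ a u : enorm (a *: u) = `|a| * enorm u.
Proof.
by rewrite /enorm dotvZl dotvZr mulrA -expr2 sqrtrM ?sqr_ge0 // sqrtr_sqr.
Qed.

Lemma enormN u : enorm (- u) = enorm u.
Proof. by rewrite -scaleN1r enormZ normrN normr1 mul1r. Qed.

Lemma enormBC u v : enorm (u - v) = enorm (v - u).
Proof. by rewrite -enormN opprB. Qed.

(** Cauchy-Schwarz: the squared norm of [enorm v *: u - enorm u *: v] is
    [2 |u| |v| (|u| |v| - <u, v>)]. *)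
Lemma dotv_le u v : dotv u v <= enorm u * enorm v.
Proof.
have [->|v0] := eqVneq v 0; first by rewrite dotvC dotv0l enorm0 mulr0.
have [->|u0] := eqVneq u 0; first by rewrite dotv0l enorm0 mul0r.
have := dotvv_ge0 (enorm v *: u - enorm u *: v).
rewrite !dotvE -!enorm_sqr (dotvC v u).
have := enorm_gt0 v0; have := enorm_gt0 u0.
move: (enorm u) (enorm v) (dotv u v) => a b d a0 b0 h.
rewrite -subr_ge0 -(pmulr_rge0 _ (mulr_gt0 a0 b0)) -(@pmulr_rge0 _ 2) //.
by apply: le_trans h _; rewrite le_eqVlt; apply/orP; left; apply/eqP; ring.
Qed.

Lemma dotv_ge u v : - (enorm u * enorm v) <= dotv u v.
Proof. by rewrite lerNl -dotvNl -(enormN u) dotv_le. Qed.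

Lemma enormD u v : enorm (u + v) <= enorm u + enorm v.
Proof.
rewrite -(@ler_pXn2r _ 2) ?nnegrE ?addr_ge0 ?enorm_ge0 //.
rewrite sqrrD !enorm_sqr !dotvE (dotvC v u).
have := dotv_le u v; lra.
Qed.

Lemma enormB_triangle u v w : enorm (u - w) <= enorm (u - v) + enorm (v - w).
Proof. by apply: le_trans (enormD _ _); rewrite addrA subrK. Qed.

Lemma enorm_sqrD u v :
  enorm (u + v) ^+ 2 = enorm u ^+ 2 + 2 * dotv u v + enorm v ^+ 2.
Proof. by rewrite !enorm_sqr !dotvE (dotvC v u); ring. Qed.

Lemma enorm_sqrB u v :
  enorm (u - v) ^+ 2 = enorm u ^+ 2 - 2 * dotv u v + enorm v ^+ 2.
Proof. by rewrite enorm_sqrD dotvNr enormN; ring. Qed.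

Lemma normr_le_enorm x : `|x| <= enorm x.
Proof.
rewrite /Num.norm /= mx_normrE; apply/bigmax_leP; split; first exact: enorm_ge0.
move=> [i j] _ /=; rewrite (ord1 i) -(@ler_pXn2r _ 2) ?nnegrE ?enorm_ge0 //.
rewrite enorm_sqr real_normK ?num_real // /dotv (bigD1 j) //= -expr2.
by rewrite lerDl sumr_ge0 // => l _; rewrite -expr2 sqr_ge0.
Qed.

Lemma coord_le_normr x i : `|x ord0 i| <= `|x|.
Proof.
rewrite [leRHS]/Num.norm /= mx_normrE.
exact: (le_bigmax _ (fun ij => `|x ij.1 ij.2|) (ord0, i)).
Qed.

Lemma enorm_le_normr x : enorm x <= n%:R * `|x|.
Proof.
rewrite -(@ler_pXn2r _ 2) ?nnegrE ?mulr_ge0 ?enorm_ge0 //.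
rewrite enorm_sqr /dotv.
apply: (@le_trans _ _ (\sum_(i < n) `|x| ^+ 2)).
  apply: ler_sum => i _; rewrite -expr2 -real_normK ?num_real //.
  by rewrite ler_pXn2r ?nnegrE // coord_le_normr.
rewrite sumr_const card_ord -[leLHS]mulr_natl exprMn ler_wpM2r ?sqr_ge0 //.
by rewrite -natrX ler_nat; case: (n) => // m; rewrite expnS expn1 leq_pmulr.
Qed.

(** The ambient topology comes from the maximum norm, equivalent to [enorm] up to the factor [n].
    Dividing by [n.+1] also covers dimension 0. *)
Lemma nbhs_enormP x (A : set 'rV[R]_n) :
  nbhs x A <-> exists2 e, 0 < e & forall y, enorm (y - x) < e -> A y.
Proof.
split=> [/nbhs_ballP [e /= e0 h]|[e e0 h]].
  exists e => // y yx; apply: h; rewrite -ball_normE /= distrC.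
  exact: le_lt_trans (normr_le_enorm _) yx.
apply/nbhs_ballP; exists (e / n.+1%:R) => /=; first by rewrite divr_gt0.
move=> y; rewrite -ball_normE /= distrC => xy; apply: h.
apply: le_lt_trans (enorm_le_normr _) _.
apply: (@le_lt_trans _ _ (n.+1%:R * `|y - x|)).
  by rewrite ler_wpM2r // ler_nat.
by rewrite mulrC -ltr_pdivlMr ?ltr0n.
Qed.

Lemma cluster_enormP (u : nat -> 'rV[R]_n) x :
  cluster (u @ \oo) x <->
  forall e N, 0 < e -> exists2 i, (N <= i)%N & enorm (u i - x) < e.
Proof.
split=> [h e N e0|h A B [N _ uA] /nbhs_enormP[e e0 eB]].
  have [] := h [set y | exists2 i, (N <= i)%N & y = u i]
    [set y | enorm (y - x) < e].
  - by exists N => // i /= Ni; exists i.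
  - by apply/nbhs_enormP; exists e.
  - by move=> y [[i Ni ->]] /= ?; exists i.
have [i Ni ui] := h e N e0.
by exists (u i); split; [exact: uA|exact: eB].
Qed.

Lemma closed_enorm_lim (A : set 'rV[R]_n) x : closed A ->
  (forall e, 0 < e -> exists2 y, A y & enorm (y - x) < e) -> A x.
Proof.
move=> cA h; apply: cA => B /nbhs_enormP[e e0 eB].
by have [y Ay yx] := h e e0; exists y; split => //; exact: eB.
Qed.

(** Bolzano-Weierstrass, by compactness of a closed ball of the maximum norm; the radius [M + 1] is
    positive even when [M = 0]. *)
Lemma bounded_seq_cluster (u : nat -> 'rV[R]_n) M :
  (forall i, enorm (u i) <= M) ->
  exists x, forall e N, 0 < e -> exists2 i, (N <= i)%N & enorm (u i - x) < e.
Proof.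
move=> uM.
have M1 : 0 < M + 1.
  rewrite (le_lt_trans (enorm_ge0 (u 0%N))) // (le_lt_trans (uM _)) //.
  by rewrite ltrDl.
have cK : compact (closed_ball (0 : 'rV[R]_n) (M + 1)).
  apply: bounded_closed_compact; last exact: closed_ball_closed.
  exists (M + 1); split=> [|N MN x]; first exact: num_real.
  rewrite closed_ballE // /closed_ball_ /= sub0r normrN => xM.
  exact/(le_trans xM)/ltW.
have := @cK (u @ \oo) _.
case.
  exists 0%N => // i _ /=; rewrite closed_ballE // /closed_ball_ /= sub0r normrN.
  apply: le_trans (normr_le_enorm _) _; apply: le_trans (uM i) _.
  by rewrite lerDl.
by move=> x [_ /cluster_enormP ?]; exists x.
Qed.

(** A maximizing sequence is bounded, and its cluster point is a maximizer. Projections, proximal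
    points and points farthest from [C] are all obtained this way. *)
Lemma lipschitz_attains_max (f : 'rV[R]_n -> R) (A : set 'rV[R]_n) M L :
  A !=set0 -> closed A -> (forall x, A x -> enorm x <= M) ->
  (forall x y, A x -> A y -> `|f x - f y| <= L * enorm (x - y)) ->
  exists2 x, A x & forall y, A y -> f y <= f x.
Proof.
move=> [a Aa] cA AM fL'.
have [K [K0 fL]] : exists K, 0 < K /\
    forall x y, A x -> A y -> `|f x - f y| <= K * enorm (x - y).
  exists (`|L| + 1); split=> [|x y Ax Ay]; first by rewrite ltr_wpDl.
  apply: le_trans (fL' _ _ Ax Ay) _; rewrite ler_wpM2r ?enorm_ge0 //.
  by apply: le_trans (ler_norm L) _; rewrite lerDl.
have hs : has_sup (f @` A).
  split; first by exists (f a), a.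
  exists (f a + K * (M + M)) => _ [x Ax <-].
  have : enorm (x - a) <= M + M.
    by apply: le_trans (enormD _ _) _; rewrite enormN lerD ?AM.
  rewrite -(ler_pM2l K0) -lerBlDl; apply: le_trans.
  exact: le_trans (ler_norm _) (fL _ _ Ax Aa).
have seqP (i : nat) : exists x, A x /\ sup (f @` A) - i.+1%:R^-1 < f x.
  have [|_ [x Ax <-] ?] := @sup_adherent _ (f @` A) i.+1%:R^-1 _ hs.
    by rewrite invr_gt0.
  by exists x.
have [u uP] := choice seqP.
have [x xu] := @bounded_seq_cluster u M (fun i => AM _ (uP i).1).
have Ax : A x.
  apply: closed_enorm_lim => // e e0; have [i _ ui] := xu e 0%N e0.
  by exists (u i) => //; exact: (uP i).1.
exists x => // y Ay.
have fys : f y <= sup (f @` A) by apply: sup_upper_bound => //; exists y.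
apply: le_trans fys _.
apply/ler_addgt0Pr => e e0.
have e2 : 0 < e / 2 by rewrite divr_gt0.
have e2K : 0 < e / 2 / K by rewrite divr_gt0.
have [N _ hN] := near_infty_natSinv_lt (PosNum e2).
have [i Ni ui] := xu _ N e2K.
have [Aui sui] := uP i.
have := fL _ _ Aui Ax.
have := hN i Ni; rewrite /=.
have := ui; rewrite ltr_pdivlMr // mulrC.
have := ler_norm (f (u i) - f x).
move: (i.+1%:R^-1) sui (K * _) => b sui c; lra.
Qed.
End Euclid.

(** * Metric projections and the uniform proximal normal inequality *)

Section Projection.
Variables (R : realType) (n : nat) (C : set 'rV[R]_n).
Implicit Types (x y z p q a h v : 'rV[R]_n) (r t : R).

Lemma closed_enorm_ball z r : closed [set x | enorm (x - z) <= r].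
Proof.
move=> x /= xA; apply/ler_addgt0Pr => e e0.
have /xA [y [/= yr yx]] : nbhs x [set y | enorm (y - x) < e].
  by apply/nbhs_enormP; exists e.
rewrite [leRHS]addrC; apply: le_trans (enormB_triangle _ y _) _.
by rewrite lerD // enormBC ltW.
Qed.

Lemma enorm_le_ball z r x : enorm (x - z) <= r -> enorm x <= r + enorm z.
Proof.
move=> xr; rewrite -[x in leLHS](subrK z).
by apply: le_trans (enormD _ _) _; rewrite lerD2r.
Qed.

Lemma enorm_dist_lipschitz z x y :
  `|enorm (z - x) - enorm (z - y)| <= enorm (x - y).
Proof.
rewrite ler_norml; apply/andP; split.
  have := enormB_triangle z x y; lra.
have := enormB_triangle z y x; rewrite (enormBC y x); lra.
Qed.

(** Only points of [C] no farther from [z] than a fixed [a] compete, so the search is over a closed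
    bounded set. *)
Lemma in_proj_exists z : C !=set0 -> closed C -> exists p, in_proj C z p.
Proof.
move=> [a Ca] cC.
have [||x [Cx xz]|x y _ _|x [Cx xz] xmin] := @lipschitz_attains_max R n
    (fun x => - enorm (z - x))
    (C `&` [set x | enorm (x - z) <= enorm (a - z)])
    (enorm (a - z) + enorm z) 1.
- by exists a; split=> /=.
- by apply: closedI => //; exact: closed_enorm_ball.
- exact: enorm_le_ball.
- by rewrite mul1r -opprD normrN; exact: enorm_dist_lipschitz.
exists x; split=> // y Cy.
have [ya|ya] := leP (enorm (y - z)) (enorm (a - z)).
  by rewrite -lerN2; apply: xmin.
by rewrite enormBC (le_trans xz) // ltW // (enormBC z).
Qed.

(** A point of [C] closer than [q] to a point of the segment would, by the triangle inequality, also
    be closer to [y]. *)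
Lemma in_proj_segment y q t : 0 <= t <= 1 -> in_proj C y q ->
  in_proj C (q + t *: (y - q)) q.
Proof.
move=> /andP[t0 t1] [Cq qmin]; split=> // c Cc.
have := qmin c Cc.
have := enormB_triangle y (q + t *: (y - q)) c.
have -> : y - (q + t *: (y - q)) = (1 - t) *: (y - q).
  by apply/rowP => i; rewrite !mxE; ring.
rewrite (addrC q) addrK !enormZ !ger0_norm ?subr_ge0 //.
move: (enorm _) (enorm _) (enorm _) => A B D; lra.
Qed.

(* Moving from [y] in the direction [h] does not increase the distance to [C],
   whose derivative along [h] is [dotv h (y - q) / enorm (y - q)]. *)
Lemma dotv_proj_le0 y q h t0 : closed C -> 0 < t0 ->
  (forall p, in_proj C y p -> p = q) -> in_proj C y q ->
  (forall t, 0 < t <= t0 -> exists2 p, in_proj C (y + t *: h) p &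
     enorm (y + t *: h - p) <= enorm (y - q)) ->
  dotv h (y - q) <= 0.
Proof.
move=> cC t00 uq [Cq qmin] hmax.
(* Projections [P i] of the points moved by [t0 / i.+1] stay bounded; they will be shown to
   accumulate at [q]. *)
have seqP (i : nat) : exists p, in_proj C (y + (t0 / i.+1%:R) *: h) p /\
    enorm (y + (t0 / i.+1%:R) *: h - p) <= enorm (y - q).
  have [|p ? ?] := hmax (t0 / i.+1%:R); last by exists p.
  rewrite divr_gt0 //= ler_pdivrMr // ler_peMr ?(ltW t00) //.
  by rewrite ler1n.
have [P PP] := choice seqP.
have ti0 (i : nat) : 0 < t0 / i.+1%:R by rewrite divr_gt0.
have ti1 (i : nat) : t0 / i.+1%:R <= t0.
  by rewrite ler_pdivrMr // ler_peMr ?(ltW t00) // ler1n.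
have yP (i : nat) : enorm (y - P i) <= t0 / i.+1%:R * enorm h + enorm (y - q).
  have [_ Pq] := PP i.
  apply: le_trans (enormB_triangle _ (y + (t0 / i.+1%:R) *: h) _) _.
  by rewrite lerD // opprD addNKr enormN enormZ gtr0_norm.
have [i|p pP] := @bounded_seq_cluster R n P (t0 * enorm h + enorm (y - q) + enorm y).
  apply: enorm_le_ball; rewrite enormBC; apply: le_trans (yP i) _.
  by rewrite lerD2r ler_wpM2r ?enorm_ge0.
have Cp : C p.
  apply: closed_enorm_lim => // e e0; have [i _ ?] := pP e 0%N e0.
  by exists (P i) => //; exact: (PP i).1.1.
(* By [yP], [enorm (y - P i)] exceeds the minimal distance by a vanishing amount, so the cluster
   point [p] is a projection of [y], and uniqueness applies. *)
have -> : q = p.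
  apply/esym/uq; split=> // c Cc; apply: le_trans (qmin c Cc).
  apply/ler_addgt0Pr => e e0.
  have e2 : 0 < e / 2 by rewrite divr_gt0.
  have hh : 0 < t0 * enorm h + 1 by rewrite ltr_wpDl // mulr_ge0 ?enorm_ge0 // ltW.
  have e2h : 0 < e / 2 / (t0 * enorm h + 1) by rewrite divr_gt0.
  have [N _ hN] := near_infty_natSinv_lt (PosNum e2h).
  have [i Ni ui] := pP _ N e2.
  have := hN i Ni; rewrite /= ltr_pdivlMr // => hNi.
  have := yP i; have := enormB_triangle y (P i) p.
  have : 0 < i.+1%:R^-1 :> R by rewrite invr_gt0.
  move: (i.+1%:R^-1) hNi => b; move: ui; lra.
apply/ler_addgt0Pr => e e0; rewrite add0r.
have hh : 0 < enorm h + 1 by rewrite ltr_wpDl // enorm_ge0.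
have eh : 0 < e / (enorm h + 1) by rewrite divr_gt0.
have [i _ ui] := pP _ 0%N eh.
have -> : y - p = (y - P i) + (P i - p) by rewrite addrA subrK.
rewrite dotvDr.
(* The moved point is no farther from [P i] than [y] is; expanding squares leaves the inner product
   plus a nonnegative term, and the positive step is divided out. *)
have le0 : dotv h (y - P i) <= 0.
  have [[CPi Pimin] Pq] := PP i.
  have := le_trans Pq (qmin _ CPi).
  rewrite -(@ler_pXn2r _ 2) ?nnegrE ?enorm_ge0 //.
  rewrite addrAC enorm_sqrD dotvZr (dotvC _ h) => le.
  rewrite -(pmulr_rle0 _ (ti0 i)).
  have := sqr_ge0 (enorm ((t0 / i.+1%:R) *: h)).
  move: le; move: (_ ^+ 2) (_ ^+ 2) (_ * dotv _ _) => A B D; lra.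
have := dotv_le h (P i - p).
have : enorm h * enorm (P i - p) <= e.
  move: ui; rewrite ltr_pdivlMr // mulrC mulrDl mul1r => ui.
  have := enorm_ge0 (P i - p); lra.
move: le0; lra.
Qed.

Lemma in_proj_dist y q p : in_proj C y q -> in_proj C y p ->
  enorm (y - q) = enorm (y - p).
Proof.
by move=> [Cq hq] [Cp hp]; apply/le_anti; rewrite hq // hp.
Qed.

(* The maximum of the distance to [C] over the ball of radius [e] around [x]
   is attained on the sphere, at a point whose projection direction is radial;
   [x] then lies between that point and its projection, so both points have
   the same projection. *)
Lemma in_proj_extend x a (e : R) : closed C -> 0 < e ->
  (forall z p q, enorm (z - x) <= e -> in_proj C z p -> in_proj C z q -> p = q) ->
  in_proj C x a -> e <= enorm (x - a) ->
  in_proj C (x + (e / enorm (x - a)) *: (x - a)) a.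
Proof.
move=> cC e0 uniq xa ea.
have [P PP] := choice (fun z => @in_proj_exists z (ex_intro _ a xa.1) cC).
(* The distance to [C] is 1-Lipschitz, hence attains its maximum on the ball. *)
have dlip z z' : enorm (z - P z) <= enorm (z - z') + enorm (z' - P z').
  apply: le_trans (enormB_triangle _ z' _).
  exact: (PP z).2 (PP z').1.
have [||z|z z' _ _|y /= yx ymax] := @lipschitz_attains_max R n
    (fun z => enorm (z - P z)) [set z | enorm (z - x) <= e] (e + enorm x) 1.
- by exists x; rewrite /= subrr enorm0 ltW.
- exact: closed_enorm_ball.
- exact: enorm_le_ball.
- rewrite mul1r ler_norml; have := dlip z z'; have := dlip z' z.
  rewrite (enormBC z' z); lra.
have dx : enorm (x - a) = enorm (x - P x) by exact: in_proj_dist.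
have dy : e <= enorm (y - P y).
  by rewrite (le_trans ea) // dx ymax //= subrr enorm0 ltW.
have d0 : 0 < enorm (y - P y) by exact: lt_le_trans dy.
have dir h t0 : 0 < t0 ->
    (forall t, 0 < t <= t0 -> enorm (y + t *: h - x) <= e) ->
    dotv h (y - P y) <= 0.
  move=> t00 ht; apply: (@dotv_proj_le0 y (P y) h t0) => //.
    by move=> p yp; exact: uniq yx yp (PP y).
  by move=> t tt; exists (P (y + t *: h)) => //; apply: ymax; exact: ht.
(* At an interior maximum the direction [y - P y] itself would be admissible, forcing its squared
   norm to be at most 0. *)
have yxe : enorm (y - x) = e.
  apply/eqP; rewrite eq_le yx /= leNgt; apply/negP => yx1.
  have t0 : 0 < (e - enorm (y - x)) / enorm (y - P y).
    by rewrite divr_gt0 // subr_gt0.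
  suff : dotv (y - P y) (y - P y) <= 0.
    by rewrite -enorm_sqr leNgt exprn_gt0.
  apply: (dir _ _ t0) => t /andP[t1]; rewrite ler_pdivlMr // => t2.
  rewrite addrAC; apply: le_trans (enormD _ _) _.
  by rewrite enormZ gtr0_norm // -lerBrDl.
have [f fE f1] : exists2 f : 'rV[R]_n, e *: f = y - x & enorm f = 1.
  exists (e^-1 *: (y - x)); first by rewrite scalerA mulfV ?gt_eqF ?scale1r.
  by rewrite enormZ gtr0_norm ?invr_gt0 // yxe mulVf // gt_eqF.
have [g gE g1] : exists2 g : 'rV[R]_n, enorm (y - P y) *: g = y - P y & enorm g = 1.
  exists ((enorm (y - P y))^-1 *: (y - P y)).
    by rewrite scalerA mulfV ?gt_eqF ?scale1r.
  by rewrite enormZ gtr0_norm ?invr_gt0 // mulVf // gt_eqF.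
(* For distinct unit vectors, moving along [g - f] stays in the ball by convexity, yet
   [<g - f, g> = 1 - <f, g>] is positive, against [dir]. *)
have gf : g = f.
  have [//|gNf] := eqVneq g f.
  have gf0 : 0 < 1 - dotv g f.
    have : 0 < enorm (g - f) ^+ 2 by rewrite exprn_gt0 // enorm_gt0 // subr_eq0.
    rewrite enorm_sqrB f1 g1; lra.
  have : dotv (g - f) (y - P y) <= 0.
    apply: (dir (g - f) e) => // t /andP[t0 te].
    have -> : y + t *: (g - f) - x = (e - t) *: f + t *: g.
      rewrite scalerBl fE.
      by apply/rowP => i; rewrite !mxE; ring.
    apply: le_trans (enormD _ _) _.
    by rewrite !enormZ f1 g1 !mulr1 (gtr0_norm t0) ger0_norm ?subr_ge0 // subrK.
  rewrite -gE dotvZr pmulr_rle0 // dotvBl -enorm_sqr g1 (dotvC f).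
  move=> gf1; exfalso; lra.
have yE : y = x + e *: g.
  by rewrite gf fE addrC subrK.
(* So [x] lies between [P y] and [y]; the coefficient is in [[0, 1]] because [e] is at most the
   distance from [y] to [C]. *)
have xE : x = P y + (1 - e / enorm (y - P y)) *: (y - P y).
  rewrite -[X in _ *: X]gE scalerA mulrBl mul1r divfK ?gt_eqF // scalerBl gE.
  by rewrite addrA (addrC (P y)) subrK {1}yE addrK.
have Pya : P y = a.
  apply: (uniq x) => //; first by rewrite subrr enorm0 ltW.
  rewrite xE; apply: in_proj_segment => //.
  by rewrite subr_ge0 ler_pdivrMr // mul1r dy /= gerBl divr_ge0 // ltW.
have -> : x + (e / enorm (x - a)) *: (x - a) = y; last by rewrite -Pya.
have xaE : x - a = (enorm (y - P y) - e) *: g.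
  rewrite -Pya scalerBl gE; move: (P y) => q; rewrite yE.
  by apply/rowP => i; rewrite !mxE; ring.
have xa0 := lt_le_trans e0 ea; move: xa0.
rewrite xaE enormZ g1 mulr1 ger0_norm ?subr_ge0 // => xa0.
by rewrite scalerA divfK ?gt_eqF // yE.
Qed.

(** Each use of [in_proj_extend] pushes the distance from [s] to [Num.min (2 * s) r], so finitely
    many doublings reach [r]. *)
Lemma in_proj_extend_radius a v t r : closed C ->
  (forall z p q, enorm (z - a) <= r -> in_proj C z p -> in_proj C z q -> p = q) ->
  enorm v = 1 -> 0 < t -> in_proj C (a + t *: v) a ->
  0 < r -> in_proj C (a + r *: v) a.
Proof.
move=> cC uniq v1 t0 ta r0.
have shrink s s' : 0 <= s' <= s -> in_proj C (a + s *: v) a ->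
    in_proj C (a + s' *: v) a.
  move=> /andP[s'0]; rewrite le_eqVlt => /orP[/eqP -> //|s's] sa.
  have s0 : 0 < s by exact: le_lt_trans s's.
  have := @in_proj_segment (a + s *: v) a (s' / s) _ sa.
  rewrite [a + s *: v](addrC a) addrK scalerA divfK ?gt_eqF //; apply.
  by rewrite divr_ge0 ?(ltW s0) //= ler_pdivrMr // mul1r ltW.
have dbl k : in_proj C (a + Num.min (2 ^+ k * t) r *: v) a.
  elim: k => [|k IH].
    rewrite expr0 mul1r; apply: shrink ta.
    by rewrite le_min (ltW t0) (ltW r0) /= ge_min lexx.
  have [rk|kr] := leP r (2 ^+ k * t).
    move: IH; rewrite (min_idPr rk) => IH.
    suff -> : Num.min (2 ^+ k.+1 * t) r = r by [].
    apply/min_idPr; rewrite exprS -mulrA (le_trans rk) //.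
    by rewrite ler_peMl ?mulr_ge0 ?exprn_ge0 ?ltW // ?ltr1n.
  move: IH; rewrite (min_idPl (ltW kr)); set s := 2 ^+ k * t in kr * => IH.
  rewrite exprS -mulrA -/s.
  have s0 : 0 < s by rewrite mulr_gt0 ?exprn_gt0.
  have sv : enorm (a + s *: v - a) = s.
    by rewrite addrC addKr enormZ v1 mulr1 gtr0_norm.
  have := @in_proj_extend (a + s *: v) a (Num.min (2 * s) r - s) cC.
  rewrite sv (addrC a (s *: v)) addrK scalerA divfK ?gt_eqF //.
  rewrite addrAC -scalerDl addrC (addrC s) subrK => ext.
  rewrite addrC; apply: ext => //.
  - by rewrite subr_gt0 lt_min kr andbT; move: s0; lra.
  (* The ball of radius [Num.min (2 * s) r - s] around [a + s *: v] stays within distance [r] of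
     [a], where projections are unique. *)
  - move=> z p q zx; apply: uniq.
    have := enormB_triangle z (a + s *: v) a.
    rewrite (addrC a) addrK enormZ v1 mulr1 gtr0_norm // => /le_trans; apply.
    by rewrite (addrC _ a) -lerBrDr (le_trans zx) // lerB // ge_min lexx orbT.
  - by rewrite lerBlDr ge_min mulr_natl mulr2n lexx.
have [k rk] : exists k : nat, r <= 2 ^+ k * t.
  exists (Num.bound (r / t)); rewrite -ler_pdivrMr //.
  apply: le_trans (ltW (archi_boundP _)) _; first by rewrite divr_ge0 ?ltW.
  by rewrite -natrX ler_nat ltnW // ltn_expl.
by have := dbl k; rewrite (min_idPr rk).
Qed.

(** With [w] normalized, [a] is nearest to the point at distance [r] along [w]; the inequality is
    the expanded square of that minimality. *)
Lemma proximal_normal_ineq a w t r : closed C ->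
  (forall z p q, enorm (z - a) <= r -> in_proj C z p -> in_proj C z q -> p = q) ->
  0 < t -> in_proj C (a + t *: w) a -> 0 < r ->
  forall y, C y -> dotv w (y - a) <= enorm w / (2 * r) * enorm (y - a) ^+ 2.
Proof.
move=> cC uniq t0 ta r0 y Cy.
have [->|w0] := eqVneq w 0; first by rewrite dotv0l enorm0 !mul0r.
have nw0 := enorm_gt0 w0.
have [|||_ /(_ y Cy)] :=
    @in_proj_extend_radius a ((enorm w)^-1 *: w) (t * enorm w) r cC uniq _ _ _ r0.
- by rewrite enormZ gtr0_norm ?invr_gt0 // mulVf ?gt_eqF.
- exact: mulr_gt0.
- by rewrite scalerA mulfK ?gt_eqF.
rewrite (addrC a) addrK -addrA -(opprB y a).
rewrite -(@ler_pXn2r _ 2) ?nnegrE ?enorm_ge0 // (enorm_sqrB (_ *: _)) -subr_ge0.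
rewrite !dotvZl => h.
have -> : enorm w / (2 * r) * enorm (y - a) ^+ 2 =
    dotv w (y - a) + enorm w / (2 * r) *
    (enorm (y - a) ^+ 2 - 2 * (r * ((enorm w)^-1 * dotv w (y - a)))).
  by field; rewrite !gt_eqF.
rewrite lerDl mulr_ge0 ?divr_ge0 ?enorm_ge0 ?mulr_ge0 ?(ltW r0) //.
by move: h; lra.
Qed.

End Projection.

(** * Proximal points and Moreau envelopes of a Lipschitz, weakly convex function *)

Definition is_prox (R : realType) n (mu : R) (g : 'rV[R]_n -> R)
    (z p : 'rV[R]_n) :=
  forall w, g p + (2 * mu)^-1 * enorm (p - z) ^+ 2
            <= g w + (2 * mu)^-1 * enorm (w - z) ^+ 2.

Section Moreau.
Variables (R : realType) (n : nat) (g : 'rV[R]_n -> R) (L eta : R).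
Hypothesis L0 : 0 < L.
Hypothesis gL : forall x y, `|g x - g y| <= L * enorm (x - y).
Hypothesis eta0 : 0 < eta.
Hypothesis gconv : weakly_convex eta g.
Implicit Types (z w p q : 'rV[R]_n) (mu : R).

Lemma lipschitz_ge w z : g z - L * enorm (w - z) <= g w.
Proof. have := gL w z; rewrite ler_norml; lra. Qed.

(** Beyond distance [2 * mu * L] the quadratic penalty outweighs any decrease of [g], so [z] itself
    does better; inside that ball the objective is Lipschitz. *)
Lemma is_prox_exists mu z : 0 < mu -> exists p, is_prox mu g z p.
Proof.
move=> mu0; pose r := 2 * mu * L.
have r0 : 0 < r by rewrite !mulr_gt0.
have m0 : 0 < (2 * mu)^-1 by rewrite invr_gt0 mulr_gt0.
have [||w|w w' wr wr'|p /= pr pmax] := @lipschitz_attains_max R n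
    (fun w => - (g w + (2 * mu)^-1 * enorm (w - z) ^+ 2))
    [set w | enorm (w - z) <= r] (r + enorm z) (L + (2 * mu)^-1 * (r + r)).
- by exists z; rewrite /= subrr enorm0 ltW.
- exact: closed_enorm_ball.
- exact: enorm_le_ball.
- have -> : - (g w + (2 * mu)^-1 * enorm (w - z) ^+ 2)
      - - (g w' + (2 * mu)^-1 * enorm (w' - z) ^+ 2) =
      (g w' - g w) + (2 * mu)^-1 * (enorm (w' - z) + enorm (w - z)) *
        (enorm (z - w') - enorm (z - w)).
    by rewrite (enormBC z w) (enormBC z w'); ring.
  apply: le_trans (ler_normD _ _) _; rewrite [leRHS]mulrDl lerD //.
    by rewrite distrC.
  rewrite normrM ger0_norm; last first.
    by rewrite mulr_ge0 ?addr_ge0 ?enorm_ge0 ?ltW.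
  apply: ler_pM => //; last by rewrite (enormBC w); exact: enorm_dist_lipschitz.
    by rewrite mulr_ge0 ?addr_ge0 ?enorm_ge0 ?ltW.
  by rewrite ler_pM2l // lerD.
exists p => w; have [wr|wr] := leP (enorm (w - z)) r.
  by rewrite -lerN2; apply: pmax.
have zr : enorm (z - z) <= r by rewrite subrr enorm0 ltW.
have := pmax z zr; rewrite lerN2 subrr enorm0 expr0n mulr0 addr0.
move=> /le_trans; apply.
have := lipschitz_ge w z; rewrite -subr_ge0.
have : 0 <= (2 * mu)^-1 * (enorm (w - z) * (enorm (w - z) - r)).
  by rewrite !mulr_ge0 ?enorm_ge0 ?subr_ge0 ?ltW.
have -> : (2 * mu)^-1 * (enorm (w - z) * (enorm (w - z) - r)) =
  (2 * mu)^-1 * enorm (w - z) ^+ 2 - L * enorm (w - z).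
  by rewrite /r; field; rewrite gt_eqF.
move: (_ * _ ^+ 2) (L * _) => A B; lra.
Qed.

(** The proximal point supplies both the lower bound that makes [inf] meaningful and the element
    attaining it. *)
Lemma moreau_prox mu z p : 0 < mu -> is_prox mu g z p ->
  moreau mu g z = g p + (2 * mu)^-1 * enorm (p - z) ^+ 2.
Proof.
move=> mu0 zp; apply/le_anti/andP; split.
  apply: ge_inf; last by exists p.
  by exists (g p + (2 * mu)^-1 * enorm (p - z) ^+ 2) => _ [w _ <-]; exact: zp.
apply: lb_le_inf; first by eexists; exists p.
by move=> _ [w _ <-]; exact: zp.
Qed.

Lemma moreau_le mu z w : 0 < mu ->
  moreau mu g z <= g w + (2 * mu)^-1 * enorm (w - z) ^+ 2.
Proof.
move=> mu0; have [p zp] := is_prox_exists z mu0.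
by rewrite (moreau_prox mu0 zp); exact: zp.
Qed.

Lemma prox_dist_le mu z p : 0 < mu -> is_prox mu g z p ->
  enorm (p - z) <= 2 * mu * L.
Proof.
move=> mu0 /(_ z); rewrite subrr enorm0 expr0n mulr0 addr0 => zp.
have [->|pz] := eqVneq p z.
  by rewrite subrr enorm0 !mulr_ge0 // ltW.
have d0 : 0 < enorm (p - z) by rewrite enorm_gt0 // subr_eq0.
rewrite -(ler_pM2r d0) -expr2 -subr_ge0.
have -> : 2 * mu * L * enorm (p - z) - enorm (p - z) ^+ 2 =
  2 * mu * (L * enorm (p - z) - (2 * mu)^-1 * enorm (p - z) ^+ 2).
  by field; rewrite gt_eqF.
rewrite !mulr_ge0 ?(ltW mu0) // subr_ge0.
have := lipschitz_ge p z; lra.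
Qed.

(** Quadratic growth: the proximal objective has convexity modulus [mu^-1 - eta], of whatever sign.
    Minimality against [t *: w + (1 - t) *: p] is divided by [t], then [t] tends to 0. *)
Lemma prox_strong mu z p w : 0 < mu -> is_prox mu g z p ->
  g p + (2 * mu)^-1 * enorm (p - z) ^+ 2
    + (mu^-1 - eta) / 2 * enorm (w - p) ^+ 2
  <= g w + (2 * mu)^-1 * enorm (w - z) ^+ 2.
Proof.
move=> mu0 zp.
set A := g w + _; set B := g p + _; set D := _ / 2 * _.
have key t : 0 < t <= 1 -> B + (1 - t) * D <= A.
  move=> /andP[t0 t1].
  have := zp (t *: w + (1 - t) *: p).
  have := @gconv w p t; rewrite (ltW t0) t1 => /(_ isT).
  have -> : enorm (t *: w + (1 - t) *: p) ^+ 2 = t * enorm w ^+ 2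
      + (1 - t) * enorm p ^+ 2 - t * (1 - t) * enorm (w - p) ^+ 2.
    by rewrite !enorm_sqr !dotvE (dotvC p w); ring.
  have -> : enorm (t *: w + (1 - t) *: p - z) ^+ 2 = t * enorm (w - z) ^+ 2
      + (1 - t) * enorm (p - z) ^+ 2 - t * (1 - t) * enorm (w - p) ^+ 2.
    by rewrite !enorm_sqr !dotvE (dotvC p w) (dotvC z w) (dotvC z p); ring.
  move=> h1 h2.
  rewrite -(ler_pM2l t0) /A /B /D.
  have m2 : (2 * mu)^-1 = mu^-1 / 2 by rewrite invfM mulrC.
  move: h2; rewrite m2; move: h1.
  move: (enorm _ ^+ 2) (enorm _ ^+ 2) (enorm _ ^+ 2) (enorm _ ^+ 2) (enorm _ ^+ 2).
  move: (g _) (g _) (g _) (mu^-1).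
  move=> g1 g2 g3 m a b c d f; nra.
apply/ler_addgt0Pr => e e0.
have [D0|D0] := leP D 0.
  have := key 1; rewrite ltr01 lexx => /(_ isT); lra.
(* This makes the loss [t * D] at most [e]. *)
pose t := Num.min 1 (e / D).
have t01 : 0 < t <= 1 by rewrite lt_min ltr01 divr_gt0 //= ge_min lexx.
have := key t t01.
have : t * D <= e by rewrite -ler_pdivlMr // ge_min lexx orbT.
lra.
Qed.

(** [mu^-1 *: (z - p)] is a subgradient of [g] at [p] up to the defect of weak convexity: in
    [prox_strong] the terms [|w - p|^2 / (2 mu)] cancel. *)
Lemma prox_subgrad mu z p w : 0 < mu -> is_prox mu g z p ->
  g p + dotv (mu^-1 *: (z - p)) (w - p) - eta / 2 * enorm (w - p) ^+ 2 <= g w.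
Proof.
move=> mu0 zp; have := prox_strong w mu0 zp.
have -> : w - z = (w - p) - (z - p) by rewrite opprB addrA subrK.
rewrite (enorm_sqrB (w - p)) (enormBC z p) dotvZl (dotvC (z - p)) invfM.
lra.
Qed.

(** Test each proximal point against the other and add: [(1 - eta mu) |p - p'|^2 <= <p - p', z -
    z'>]. The factor is at least 1/2. *)
Lemma prox_lipschitz mu z z' p p' : 0 < mu -> 2 * eta * mu <= 1 ->
  is_prox mu g z p -> is_prox mu g z' p' ->
  enorm (p - p') <= 2 * enorm (z - z').
Proof.
move=> mu0 etamu zp zp'.
have h1 := prox_strong p' mu0 zp; have h2 := prox_strong p mu0 zp'.
have [->|pp] := eqVneq p p'.
  by rewrite subrr enorm0 mulr_ge0 ?enorm_ge0.
have d0 : 0 < enorm (p - p') by rewrite enorm_gt0 // subr_eq0.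
rewrite -(ler_pM2r d0) -expr2 -mulrA.
have : (1 - eta * mu) * enorm (p - p') ^+ 2 <= dotv (p - p') (z - z').
  have E : dotv (p - p') (z - z') = 2^-1 * (enorm (p' - z) ^+ 2
      - enorm (p - z) ^+ 2 + enorm (p - z') ^+ 2 - enorm (p' - z') ^+ 2).
    rewrite !enorm_sqr !dotvE (dotvC z p) (dotvC z p') (dotvC z' p) (dotvC z' p').
    by field.
  rewrite E -(ler_pM2l (_ : 0 < mu^-1)) ?invr_gt0 //.
  have -> : mu^-1 * ((1 - eta * mu) * enorm (p - p') ^+ 2) =
    (mu^-1 - eta) * enorm (p - p') ^+ 2 by field; rewrite gt_eqF.
  move: h1 h2; rewrite (enormBC p' p) invfM; lra.
have := dotv_le (p - p') (z - z').
have := sqr_ge0 (enorm (p - p')).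
rewrite (mulrC (enorm (z - z'))).
move: (enorm _ ^+ 2) (_ * enorm _) (dotv _ _) etamu => a b c; nra.
Qed.

Lemma moreau_upper mu z z' p : 0 < mu -> is_prox mu g z p ->
  moreau mu g z' <= moreau mu g z + dotv (mu^-1 *: (z - p)) (z' - z)
                    + (2 * mu)^-1 * enorm (z' - z) ^+ 2.
Proof.
move=> mu0 zp; rewrite (moreau_prox mu0 zp).
apply: le_trans (moreau_le z' p mu0) _.
have -> : p - z' = (p - z) - (z' - z) by rewrite opprB addrA subrK.
rewrite (enorm_sqrB (p - z)) -(opprB p z) dotvZl dotvNl invfM; lra.
Qed.

(** Apply [moreau_upper] from [z'] back to [z], then replace the proximal point of [z'] by that of
    [z]. The factor 2 of [prox_lipschitz] accounts for the constant 3. *)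
Lemma moreau_lower mu z z' p : 0 < mu -> 2 * eta * mu <= 1 ->
  is_prox mu g z p ->
  moreau mu g z + dotv (mu^-1 *: (z - p)) (z' - z)
    - (2 * mu)^-1 * 3 * enorm (z' - z) ^+ 2 <= moreau mu g z'.
Proof.
move=> mu0 etamu zp; have [q zq] := is_prox_exists z' mu0.
have := moreau_upper z mu0 zq.
have h := prox_lipschitz mu0 etamu zp zq.
have := dotv_le (q - p) (z' - z).
have e0 := enorm_ge0 (z' - z).
have : enorm (q - p) * enorm (z' - z) <= 2 * enorm (z' - z) ^+ 2.
  by rewrite expr2 mulrA ler_wpM2r // enormBC (enormBC z').
rewrite !dotvZl -(opprB z' z) dotvNr enormN.
have -> : dotv (z' - q) (z' - z) =
    enorm (z' - z) ^+ 2 - dotv (q - p) (z' - z) + dotv (z - p) (z' - z).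
  by rewrite enorm_sqr !dotvE; ring.
rewrite invfM => h1 h2.
have m0 : 0 < mu^-1 by rewrite invr_gt0.
have := le_trans h2 h1; rewrite -(ler_pM2l m0).
move: (mu^-1) (_ ^+ 2) (dotv _ _) (dotv _ _) => a b c d; lra.
Qed.

(** Reducing [mu] raises the envelope; testing with the old proximal point, at distance at most
    [2 * mu * L], bounds the increase. The ratio [mu / mu' <= 2] gives the constant 4. *)
Lemma moreau_decr mu mu' z : 0 < mu' -> mu' <= mu -> mu <= 2 * mu' ->
  moreau mu' g z <= moreau mu g z + 4 * L ^+ 2 * (mu - mu').
Proof.
move=> mu'0 mm mm2; have mu0 := lt_le_trans mu'0 mm.
have [p zp] := is_prox_exists z mu0.
rewrite (moreau_prox mu0 zp); apply: le_trans (moreau_le z p mu'0) _.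
rewrite -addrA lerD2l -subr_ge0.
have := prox_dist_le mu0 zp; rewrite -(@ler_pXn2r _ 2) ?nnegrE ?enorm_ge0 //;
  last by rewrite !mulr_ge0 // ltW.
move: (enorm _ ^+ 2) => d dL.
have -> : (2 * mu)^-1 * d + 4 * L ^+ 2 * (mu - mu') - (2 * mu')^-1 * d =
   (mu - mu') / (2 * mu' * mu) * (8 * L ^+ 2 * mu' * mu - d).
  by field; rewrite !gt_eqF.
rewrite mulr_ge0 ?divr_ge0 ?subr_ge0 ?mulr_ge0 ?(ltW mu0) ?(ltW mu'0) //.
apply: le_trans dL _; rewrite -subr_ge0.
have -> : 8 * L ^+ 2 * mu' * mu - (2 * mu * L) ^+ 2 =
  4 * L ^+ 2 * mu * (2 * mu' - mu) by ring.
by rewrite !mulr_ge0 ?sqr_ge0 ?subr_ge0 // ltW.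
Qed.

Lemma moreau_ge mu z : 0 < mu -> g z - 2 * L ^+ 2 * mu <= moreau mu g z.
Proof.
move=> mu0; have [p zp] := is_prox_exists z mu0.
rewrite (moreau_prox mu0 zp); apply: (@le_trans _ _ (g p)); last first.
  by rewrite lerDl mulr_ge0 ?sqr_ge0 // invr_ge0 mulr_ge0 // ltW.
apply: le_trans (lipschitz_ge p z); rewrite lerD2l lerN2.
have /(ler_wpM2l (ltW L0)) := prox_dist_le mu0 zp.
by move=> /le_trans; apply; rewrite le_eqVlt; apply/orP; left; apply/eqP; ring.
Qed.

End Moreau.

(** * Inner products as differentiable maps, and identification of gradients *)

Section DotvLinear.
Variables (R : realType) (n : nat) (u : 'rV[R]_n).

Fact dotv_linear : linear (dotv u : 'rV[R]_n -> R).
Proof. by move=> a v w; rewrite dotvDr dotvZr. Qed.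

HB.instance Definition _ :=
  GRing.isLinear.Build R 'rV[R]_n R _ (dotv u) dotv_linear.

Lemma dotv_continuous : continuous (dotv u : 'rV[R]_n -> R).
Proof.
apply/bounded_linear_continuous/bounded_funP => r.
exists (enorm u * (n%:R * r)) => v vr.
have : `|dotv u v| <= enorm u * enorm v.
  by rewrite ler_norml dotv_ge dotv_le.
move=> /le_trans; apply; rewrite ler_wpM2l ?enorm_ge0 //.
by apply: le_trans (enorm_le_normr _) _; rewrite ler_wpM2l.
Qed.

Lemma dotv_differentiable v : differentiable (dotv u : 'rV[R]_n -> R) v.
Proof. exact/linear_differentiable/dotv_continuous. Qed.

Lemma diff_dotv v : 'd (dotv u : 'rV[R]_n -> R) v = dotv u :> ('rV[R]_n -> R).
Proof. exact/diff_lin/dotv_continuous. Qed.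

End DotvLinear.

Lemma dotv_delta (R : realType) n (u : 'rV[R]_n) i :
  dotv u (delta_mx ord0 i) = u ord0 i.
Proof.
rewrite /dotv (bigD1 i) //= mxE !eqxx mulr1 big1 ?addr0 // => j ji.
by rewrite mxE eqxx (negbTE ji) mulr0.
Qed.

(** A quadratic error is little-o, so [dotv u] is the differential by uniqueness, and its values on
    basis vectors are the coordinates of [u]. *)
Lemma grad_unique (R : realType) n (f : 'rV[R]_n -> R) x u K :
  (forall y, `|f y - f x - dotv u (y - x)| <= K * enorm (y - x) ^+ 2) ->
  grad f x = u.
Proof.
move=> fK; apply/rowP => i; rewrite mxE.
have -> : 'd f x = dotv u :> ('rV[R]_n -> R); last exact: dotv_delta.
apply: diff_unique; first exact: dotv_continuous.
apply/eqaddoP => e e0.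
(* At this radius in the maximum norm, [|K| (n |h|)^2] is at most [e |h|]; the added 1 keeps the
   denominator positive. *)
have c0 : 0 < e / (`|K| * n%:R ^+ 2 + 1).
  by rewrite divr_gt0 // ltr_wpDl // mulr_ge0.
apply/nbhs_ballP; exists (e / (`|K| * n%:R ^+ 2 + 1)) => //= h.
rewrite -ball_normE /= sub0r normrN => hc.
have := fK (h + x); rewrite addrK => fh.
have -> : ((f \o shift x) - (cst (f x) + dotv u)) h = f (h + x) - f x - dotv u h.
  by rewrite !fctE opprD addrA.
apply: le_trans fh _.
apply: (@le_trans _ _ (`|K| * (n%:R * `|h|) ^+ 2)).
  apply: (@le_trans _ _ (`|K| * enorm h ^+ 2)).
    by rewrite ler_wpM2r ?sqr_ge0 // ler_norm.
  rewrite ler_wpM2l // ler_pXn2r ?nnegrE ?enorm_ge0 ?mulr_ge0 //.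
  exact: enorm_le_normr.
rewrite exprMn (expr2 `|h|) !mulrA ler_wpM2r //.
move: hc; rewrite ltr_pdivlMr ?ltr_wpDl ?mulr_ge0 //.
have := normr_ge0 h; move: (`|h|) (n%:R) => a b; lra.
Qed.

(** * First-order Taylor bound for a map with Lipschitz derivative *)

Section Taylor.
Variables (R : realType) (n k : nat) (S : 'rV[R]_n -> 'rV[R]_k) (L : R).
Hypothesis dS : forall y, differentiable S y.
Hypothesis SL : forall x y v,
  enorm ('d S x v - 'd S y v) <= L * enorm (x - y) * enorm v.

Lemma is_derive_dotv_line (u : 'rV[R]_k) x h (t : R) :
  is_derive t 1 (fun t => dotv u (S (x + t *: h))) (dotv u ('d S (x + t *: h) h)).
Proof.
have df z : differentiable (dotv u \o S) z.
  by apply: differentiable_comp => //; exact: dotv_differentiable.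
have E : (fun s : R => s^-1 *: (dotv u (S (x + (s *: 1 + t) *: h))
     - dotv u (S (x + t *: h)))) =
   (fun s => s^-1 *: ((dotv u \o S) (s *: h + (x + t *: h))
     - (dotv u \o S) (x + t *: h))).
  apply/funext => s /=; congr (_ *: (dotv u (S _) - _)).
  rewrite -[s *: 1]/(s * 1) mulr1 scalerDl.
  by apply/rowP => i; rewrite !mxE; ring.
have := @diff_derivable _ _ _ (dotv u \o S) (x + t *: h) h (df _).
have := @deriveE _ _ _ (dotv u \o S) (x + t *: h) h (df _).
rewrite diff_comp //=; last exact: dotv_differentiable.
rewrite diff_dotv /derive => <- dd.
split; first by rewrite /derivable /= E.
by rewrite /derive /= E.
Qed.

(** The mean value theorem needs a scalar function, so [S] is paired with its own remainder [r].
    Cauchy-Schwarz then bounds [|r|^2], and one factor [|r|] cancels. *)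
Lemma diff_taylor x y : 0 <= L ->
  enorm (S y - S x - 'd S x (y - x)) <= L * enorm (y - x) ^+ 2.
Proof.
move=> L0; set r := S y - S x - _.
have [->|r0] := eqVneq r 0; first by rewrite enorm0 mulr_ge0 ?sqr_ge0.
have [||c] := @MVT R (fun t => dotv r (S (x + t *: (y - x))))
  (fun t => dotv r ('d S (x + t *: (y - x)) (y - x))) 0 1 ltr01.
- by move=> t _; exact: is_derive_dotv_line.
- apply: derivable_within_continuous => t _.
  by have [] := is_derive_dotv_line r x (y - x) t.
rewrite in_itv /= => /andP[c0 c1].
rewrite scale1r scale0r addr0 (addrC x) subrK subr0 mulr1 -dotvBr => E.
have : dotv r r = dotv r ('d S (x + c *: (y - x)) (y - x) - 'd S x (y - x)).
  by rewrite {2}/r dotvBr E -dotvBr.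
rewrite -enorm_sqr => rE.
have := dotv_le r ('d S (x + c *: (y - x)) (y - x) - 'd S x (y - x)).
rewrite -rE expr2 ler_pM2l ?enorm_gt0 // => /le_trans; apply.
apply: le_trans (SL _ _ _) _.
rewrite (addrC x) addrK enormZ gtr0_norm // expr2 mulrA ler_wpM2r ?enorm_ge0 //.
by rewrite ler_wpM2l // ler_piMl ?enorm_ge0 // ltW.
Qed.

End Taylor.

(** * Consequences of a two-sided quadratic expansion at a point *)

Section QuadraticExpansion.
Variables (R : realType) (n : nat) (f : 'rV[R]_n -> R) (x u : 'rV[R]_n) (K : R).
Hypothesis fK :
  forall y, `|f y - f x - dotv u (y - x)| <= K * enorm (y - x) ^+ 2.
Hypothesis K0 : 0 < K.

Lemma quadratic_frechet_subdiff : frechet_subdiff (fun y => (f y)%:E) x u.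
Proof.
split=> // d d0; exists (d / K); split=> [|y /andP[y0]]; first by rewrite divr_gt0.
rewrite ltr_pdivlMr // => yd; rewrite -!EFinB lee_fin.
have := fK y; rewrite ler_norml => /andP[+ _]; apply: le_trans.
rewrite mulNr lerN2 expr2 mulrA ler_wpM2r ?enorm_ge0 // mulrC; exact: ltW.
Qed.

Lemma quadratic_frechet_subdiff_unique v :
  frechet_subdiff (fun y => (f y)%:E) x v -> v = u.
Proof.
move=> [_ fv]; have [//|vu] := eqVneq v u; exfalso.
have h0 : 0 < enorm (v - u) by rewrite enorm_gt0 // subr_eq0.
have h3 : 0 < enorm (v - u) / 3 by rewrite divr_gt0.
have [e [e0 fe]] := fv _ h3.
(* The first bound keeps the test point within [e] of [x], the second gives [t * K <= 1/3]. Moving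
   along [v - u] then yields [1 <= 1/3 + 1/3]. *)
pose t := Num.min (e / 2 / enorm (v - u)) (3 * K)^-1.
have t0 : 0 < t.
  by rewrite lt_min !divr_gt0 //= invr_gt0 mulr_gt0.
have te : t * enorm (v - u) < e.
  rewrite -ltr_pdivlMr // gt_min; apply/orP; left.
  by rewrite ltr_pM2r ?invr_gt0 //; move: e0; lra.
have tK : t * (3 * K) <= 1.
  by rewrite -ler_pdivlMr ?mulr_gt0 // ge_min div1r lexx orbT.
have yx : x + t *: (v - u) - x = t *: (v - u) by rewrite addrC addKr.
have := fK (x + t *: (v - u)); have := fe (x + t *: (v - u)).
rewrite yx enormZ gtr0_norm // te mulr_gt0 // => /(_ isT).
rewrite -!EFinB lee_fin ler_norml => h1 /andP[_ h2].
have : dotv (v - u) (t *: (v - u)) <=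
    enorm (v - u) / 3 * (t * enorm (v - u)) + K * (t * enorm (v - u)) ^+ 2.
  rewrite dotvBl; lra.
rewrite dotvZr -enorm_sqr; apply/negP; rewrite -ltNge.
have -> : enorm (v - u) / 3 * (t * enorm (v - u)) + K * (t * enorm (v - u)) ^+ 2
  = (t * enorm (v - u) ^+ 2) * (3^-1 + t * K) by ring.
rewrite gtr_pMr ?mulr_gt0 ?exprn_gt0 //; lra.
Qed.

(** Backtracking accepts every step with [gam * K <= 1/2 - c]: comparing [y] with [x] in the
    projection gives [|x - y|^2 <= 2 gam <x - y, u>], which is put into the upper expansion. *)
Lemma projected_step_decrease (C : set 'rV[R]_n) gam c y : C x -> 0 < gam ->
  gam * K <= 2^-1 - c -> in_proj C (x - gam *: u) y ->
  f y <= f x - c * gam * enorm (gam^-1 *: (x - y)) ^+ 2.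
Proof.
move=> Cx gam0 gamK [Cy /(_ x Cx)].
rewrite -(@ler_pXn2r _ 2) ?nnegrE ?enorm_ge0 //.
rewrite [x - _ - x]addrAC subrr add0r enormN [x - _ - y]addrAC.
rewrite (enorm_sqrB (x - y)) dotvZr => h.
have := fK y; rewrite ler_norml => /andP[_].
rewrite enormZ gtr0_norm ?invr_gt0 // (enormBC y) -(opprB x y) dotvNr (dotvC u).
set d := dotv (x - y) u in h *; set N := enorm (x - y) in h *.
move=> h2.
have -> : c * gam * (gam^-1 * N) ^+ 2 = gam^-1 * (c * N ^+ 2).
  by field; rewrite gt_eqF.
rewrite -(ler_pM2l gam0) mulrBr mulrA mulfV ?gt_eqF // mul1r.
have := ler_wpM2l (ltW gam0) h2.
have := ler_wpM2r (sqr_ge0 N) gamK.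
move: h; move: (_ ^+ 2) => h; lra.
Qed.

End QuadraticExpansion.

(** * The smoothed composition: expansion, gradient, and approximate stationarity *)

Section SmoothedComposition.
Variables (R : realType) (n k : nat) (S : 'rV[R]_n -> 'rV[R]_k).
Variables (g : 'rV[R]_k -> R) (L LS LD eta : R).
Hypothesis dS : forall y, differentiable S y.
Hypothesis LS0 : 0 < LS.
Hypothesis SL : forall x y, enorm (S x - S y) <= LS * enorm (x - y).
Hypothesis LD0 : 0 < LD.
Hypothesis DSL : forall x y v,
  enorm ('d S x v - 'd S y v) <= LD * enorm (x - y) * enorm v.
Hypothesis L0 : 0 < L.
Hypothesis gL : forall x y, `|g x - g y| <= L * enorm (x - y).
Hypothesis eta0 : 0 < eta.
Hypothesis gconv : weakly_convex eta g.
Implicit Types (mu : R) (x y a : 'rV[R]_n).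

Lemma enorm_diff_le x v : enorm ('d S x v) <= LS * enorm v.
Proof.
apply/ler_addgt0Pr => e e0.
have c0 : 0 < LD * enorm v ^+ 2 + 1.
  by rewrite ltr_wpDl // mulr_ge0 ?sqr_ge0 // ltW.
(* Small enough for the Taylor error [LD * (t * enorm v) ^+ 2] to be at most [t * e]. *)
pose t := e / (LD * enorm v ^+ 2 + 1).
have t0 : 0 < t by rewrite divr_gt0.
have := diff_taylor dS DSL x (x + t *: v) (ltW LD0).
have := SL (x + t *: v) x.
rewrite (addrC x) addrK linearZ /= enormZ gtr0_norm // => h1 h2.
have h3 := enormB_triangle (t *: 'd S x v) (S (t *: v + x) - S x) 0.
rewrite !subr0 (enormBC (t *: _)) enormZ gtr0_norm // in h3.
rewrite -(ler_pM2l t0).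
have : LD * (t * enorm v) ^+ 2 <= t * e.
  have -> : LD * (t * enorm v) ^+ 2 = t * (t * (LD * enorm v ^+ 2)) by ring.
  rewrite ler_pM2l // /t mulrAC ler_pdivrMr // ler_pM2l //.
  by rewrite lerDl.
move: h1 h2 h3; lra.
Qed.

(** The first term pays for linearizing [S] under a multiplier of norm at most [2 * L], the second
    for the envelope along [S y - S x]. *)
Definition curvature mu := 2 * L * LD + (2 * mu)^-1 * 3 * LS ^+ 2.

Lemma curvature_gt0 mu : 0 < mu -> 0 < curvature mu.
Proof.
move=> mu0; rewrite addr_gt0 // ?mulr_gt0 //.
by rewrite invr_gt0 mulr_gt0.
Qed.

Lemma prox_grad_le mu z p : 0 < mu -> is_prox mu g z p ->
  enorm (mu^-1 *: (z - p)) <= 2 * L.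
Proof.
move=> mu0 zp; rewrite enormZ gtr0_norm ?invr_gt0 // enormBC ler_pdivrMl //.
by apply: le_trans (prox_dist_le L0 gL mu0 zp) _; rewrite mulrCA mulrA.
Qed.

Lemma smoothed_expansion mu x y p : 0 < mu -> 2 * eta * mu <= 1 ->
  is_prox mu g (S x) p ->
  `|moreau mu g (S y) - moreau mu g (S x)
    - dotv (mu^-1 *: (S x - p)) ('d S x (y - x))|
  <= curvature mu * enorm (y - x) ^+ 2.
Proof.
move=> mu0 etamu xp; set w := mu^-1 *: _.
have w2 : enorm w <= 2 * L by exact: prox_grad_le.
have hu := moreau_upper L0 gL (S y) mu0 xp.
have hl := moreau_lower L0 gL gconv (S y) mu0 etamu xp.
rewrite -/w in hu hl.
have T := diff_taylor dS DSL x y (ltW LD0).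
have : `|dotv w (S y - S x - 'd S x (y - x))| <= 2 * L * LD * enorm (y - x) ^+ 2.
  apply: (@le_trans _ _ (enorm w * enorm (S y - S x - 'd S x (y - x)))).
    by rewrite ler_norml dotv_ge dotv_le.
  by rewrite -mulrA; apply: ler_pM => //; exact: enorm_ge0.
have : enorm (S y - S x) ^+ 2 <= LS ^+ 2 * enorm (y - x) ^+ 2.
  rewrite -exprMn ler_pXn2r ?nnegrE ?enorm_ge0 //.
  by rewrite mulr_ge0 ?enorm_ge0 // ltW.
have m0 : 0 < (2 * mu)^-1 by rewrite invr_gt0 mulr_gt0.
rewrite -(ler_pM2l m0).
have := sqr_ge0 (enorm (S y - S x)); rewrite -(pmulr_rge0 _ m0).
rewrite /curvature !ler_norml dotvBr => s1 s2 /andP[h1 h2].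
move: hu hl s1 s2 h1 h2; lra.
Qed.

(** The chain rule, without differentiating the envelope: the vector [G] of the expected partial
    derivatives satisfies the quadratic expansion, so [grad_unique] identifies it. *)
Lemma dotv_grad_smoothed mu x p v : 0 < mu -> 2 * eta * mu <= 1 ->
  is_prox mu g (S x) p ->
  dotv (grad (fun y => moreau mu g (S y)) x) v =
  dotv (mu^-1 *: (S x - p)) ('d S x v).
Proof.
move=> mu0 etamu xp; set w := mu^-1 *: _.
pose G : 'rV[R]_n := \row_i dotv w ('d S x (delta_mx ord0 i)).
have GE v' : dotv G v' = dotv w ('d S x v').
  rewrite [in RHS](row_sum_delta v') linear_sum /= linear_sum /=.
  by apply: eq_bigr => i _; rewrite mxE !linearZ /= mulrC.
rewrite (@grad_unique _ _ _ x G (curvature mu)) // => y.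
rewrite GE; exact: smoothed_expansion.
Qed.

Lemma smoothed_grad_expansion mu x : 0 < mu -> 2 * eta * mu <= 1 ->
  forall y, `|moreau mu g (S y) - moreau mu g (S x)
    - dotv (grad (fun y => moreau mu g (S y)) x) (y - x)|
  <= curvature mu * enorm (y - x) ^+ 2.
Proof.
move=> mu0 etamu y; have [p xp] := is_prox_exists L0 gL (S x) mu0.
rewrite (dotv_grad_smoothed _ mu0 etamu xp); exact: smoothed_expansion.
Qed.

(** Pairing the gradient with itself gives a bound independent of [mu], hence bounded normals as
    [mu] vanishes. *)
Lemma enorm_grad_smoothed mu x : 0 < mu -> 2 * eta * mu <= 1 ->
  enorm (grad (fun y => moreau mu g (S y)) x) <= 2 * L * LS.
Proof.
move=> mu0 etamu; have [p xp] := is_prox_exists L0 gL (S x) mu0.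
set G := grad _ _.
have [->|G0] := eqVneq G 0; first by rewrite enorm0 !mulr_ge0 // ltW.
rewrite -(ler_pM2l (enorm_gt0 G0)) -expr2 enorm_sqr.
rewrite {1}/G (dotv_grad_smoothed _ mu0 etamu xp).
apply: le_trans (dotv_le _ _) _.
have -> : enorm G * (2 * L * LS) = 2 * L * (LS * enorm G) by ring.
apply: ler_pM; rewrite ?enorm_ge0 ?enorm_diff_le //.
exact: prox_grad_le.
Qed.

(** The summands are, in order, the errors [T1], [T3], [T4], [T5], [T6] and [T7] of the next proof;
    none involves [mu] or the iterate. *)
Definition stationarity_const gt r :=
  L * (2 * L + LS) + 8 * L * LD + 2 + (2 * L * LS + 1) / (2 * r) * (2 + gt) ^+ 2
  + (2 * L * LS + 1) * gt + eta / 2 * (2 * LS + 2 * L) ^+ 2.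

(* With [D := enorm (y - xs)], each error term is at most linear in [e] or
   quadratic in [D + e], hence a multiple of [D ^+ 2] once [e <= D, D ^+ 2]. *)
Lemma stationarity_step (C : set 'rV[R]_n) xs x a y (gam gt mu r e : R) :
  closed C -> C y -> 0 < r ->
  (forall z p q, enorm (z - a) <= r -> in_proj C z p -> in_proj C z q -> p = q) ->
  0 < gam <= gt -> 0 < mu <= e -> 2 * eta * mu <= 1 ->
  in_proj C (x - gam *: grad (fun y => moreau mu g (S y)) x) a ->
  enorm (gam^-1 *: (x - a)) <= e -> enorm (x - xs) <= e ->
  e <= 1 -> e <= enorm (y - xs) -> e <= enorm (y - xs) ^+ 2 ->
  g (S xs) - stationarity_const gt r * enorm (y - xs) ^+ 2 <= g (S y).
Proof.
move=> cC Cy r0 uniq /andP[gam0 gamt] /andP[mu0 mue] etamu xa ae xxs e1 eD eD2.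
have gt0 : 0 < gt by exact: lt_le_trans gamt.
have e0 : 0 < e by exact: lt_le_trans mue.
set D := enorm (y - xs) in eD eD2 *.
have D0 : 0 < D by exact: lt_le_trans eD.
have [p xp] := is_prox_exists L0 gL (S x) mu0.
pose w := mu^-1 *: (S x - p).
have w2 : enorm w <= 2 * L by exact: prox_grad_le.
pose G := grad (fun y => moreau mu g (S y)) x.
have GE v : dotv G v = dotv w ('d S x v) by exact: dotv_grad_smoothed.
pose ee := gam^-1 *: (x - a).
(* A proximal normal at [a], since [a + gam *: v] is the point being projected. *)
pose v := ee - G.
have V : enorm v <= 2 * L * LS + 1.
  rewrite addrC; apply: le_trans (enormD _ _) _; rewrite enormN.
  by apply: lerD; [exact: le_trans ae e1|exact: enorm_grad_smoothed].
have xaE : enorm (x - a) <= gt * e.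
  have -> : x - a = gam *: ee by rewrite scalerA mulfV ?gt_eqF // scale1r.
  rewrite enormZ gtr0_norm //; apply: ler_pM; rewrite ?enorm_ge0 //; exact: ltW.
have yx : enorm (y - x) <= 2 * D.
  have := enormB_triangle y xs x; rewrite (enormBC xs) -/D; move: xxs eD; lra.
have ya : enorm (y - a) <= (2 + gt) * D.
  have := enormB_triangle y xs a; have := enormB_triangle xs x a.
  rewrite (enormBC xs x) -/D => h1 h2.
  have : gt * e <= gt * D by rewrite ler_pM2l.
  move: xxs eD xaE h1 h2; lra.
have pSx : enorm (p - S x) <= 2 * L * e.
  apply: le_trans (prox_dist_le L0 gL mu0 xp) _.
  have -> : 2 * mu * L = 2 * L * mu by ring.
  by rewrite ler_wpM2l // mulr_ge0 // ltW.
have T1 : g (S xs) - L * (2 * L + LS) * D ^+ 2 <= g p.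
  apply: le_trans (lipschitz_ge gL p (S xs)); rewrite lerD2l lerN2 -mulrA.
  rewrite ler_pM2l //.
  apply: (@le_trans _ _ ((2 * L + LS) * e)); last first.
    by rewrite ler_wpM2l // addr_ge0 ?mulr_ge0 // ltW.
  have := enormB_triangle p (S x) (S xs); have := SL x xs.
  have : LS * enorm (x - xs) <= LS * e by rewrite ler_pM2l.
  move: pSx; lra.
(* The dropped term [<w, S x - p>] is [|S x - p|^2 / mu], hence nonnegative. *)
have T2 : dotv w (S y - S x) <= dotv w (S y - p).
  have -> : S y - p = (S y - S x) + (S x - p) by rewrite addrA subrK.
  rewrite (dotvDr (S y - S x)) lerDl dotvZl mulr_ge0 ?dotvv_ge0 // invr_ge0.
  exact: ltW.
have sqD (t s : R) : 0 <= t -> t <= s * D -> t ^+ 2 <= s ^+ 2 * D ^+ 2.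
  by move=> t0 ts; rewrite -exprMn ler_pXn2r ?nnegrE ?(le_trans t0).
have T3 : dotv G (y - x) - 8 * L * LD * D ^+ 2 <= dotv w (S y - S x).
  rewrite GE.
  have := dotv_ge w (S y - S x - 'd S x (y - x)).
  have : enorm w * enorm (S y - S x - 'd S x (y - x)) <= 2 * L * (LD * (4 * D ^+ 2)).
    apply: ler_pM => //; try exact: enorm_ge0.
    apply: le_trans (diff_taylor dS DSL x y (ltW LD0)) _.
    rewrite ler_pM2l //; have := sqD _ _ (enorm_ge0 (y - x)) yx.
    lra.
  rewrite dotvBr; lra.
have T4 : - (2 * D ^+ 2) <= dotv ee (y - x).
  have := dotv_ge ee (y - x).
  have : enorm ee * enorm (y - x) <= D * (2 * D).
    apply: ler_pM => //; try exact: enorm_ge0.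
    exact: le_trans eD.
  lra.
have T5 : dotv v (y - a) <= (2 * L * LS + 1) / (2 * r) * (2 + gt) ^+ 2 * D ^+ 2.
  have xa' : in_proj C (a + gam *: v) a.
    suff -> : a + gam *: v = x - gam *: G by [].
    rewrite scalerBr scalerA mulfV ?gt_eqF // scale1r.
    by rewrite addrA (addrC a) subrK.
  apply: le_trans (proximal_normal_ineq cC uniq gam0 xa' r0 Cy) _.
  rewrite -[leRHS]mulrA; apply: ler_pM.
  - by rewrite divr_ge0 ?enorm_ge0 // mulr_ge0 // ltW.
  - exact: sqr_ge0.
  - by rewrite ler_pM2r // invr_gt0 mulr_gt0.
  - exact: sqD (enorm_ge0 _) ya.
have T6 : dotv v (a - x) <= (2 * L * LS + 1) * gt * D ^+ 2.
  apply: le_trans (dotv_le _ _) _; rewrite -mulrA.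
  apply: ler_pM; rewrite ?enorm_ge0 // enormBC (le_trans xaE) //.
  by rewrite ler_pM2l.
have T7 : eta / 2 * enorm (S y - p) ^+ 2 <=
    eta / 2 * (2 * LS + 2 * L) ^+ 2 * D ^+ 2.
  rewrite -[leRHS]mulrA ler_pM2l ?divr_gt0 //; apply: sqD (enorm_ge0 _) _.
  have := enormB_triangle (S y) (S x) p; rewrite (enormBC (S x)).
  have := SL y x; have : LS * enorm (y - x) <= LS * (2 * D) by rewrite ler_pM2l.
  have : 2 * L * e <= 2 * L * D by rewrite ler_pM2l // mulr_gt0.
  move: pSx; lra.
have := prox_subgrad gconv (S y) mu0 xp; rewrite -/w.
(* Splitting [G = ee - v] and [y - x = (y - a) + (a - x)] isolates the normal term bounded by
   [T5]. *)
have GV : dotv G (y - x) = dotv ee (y - x) - dotv v (y - a) - dotv v (a - x).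
  by rewrite /v !dotvE; ring.
rewrite GV in T3.
rewrite /stationarity_const; move: T1 T2 T3 T4 T5 T6 T7.
move: (dotv _ _) (dotv _ _) (dotv _ _) (dotv _ _) (dotv _ _) => d1 d2 d3 d4 d5.
lra.
Qed.

End SmoothedComposition.

(** * Real powers of the index, harmonic descent, and lower limits *)

Section PowerSteps.
Variables (R : realType) (a : R).
Hypothesis a01 : 0 < a <= 1.

Lemma natpowR_gt0 (j : nat) : (1 <= j)%N -> 0 < j%:R `^ a :> R.
Proof. by move=> j1; rewrite powR_gt0 // ltr0n. Qed.

Lemma natpowRN_le1 (j : nat) : (1 <= j)%N -> j%:R `^ (- a) <= 1 :> R.
Proof.
move=> j1; have /andP[a0 a1] := a01.
rewrite powRN invf_le1 ?natpowR_gt0 //.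
by rewrite -[leLHS](powRr0 j%:R) ler_powR ?ler1n // ltW.
Qed.

Lemma natpowRN_ge (j : nat) : (1 <= j)%N -> j%:R^-1 <= j%:R `^ (- a) :> R.
Proof.
move=> j1; have /andP[a0 a1] := a01.
by rewrite powRN lef_pV2 ?posrE ?natpowR_gt0 ?ltr0n // ler1_powR // ler1n.
Qed.

Lemma natpowRN_decr (j : nat) : (1 <= j)%N ->
  j.+1%:R `^ (- a) <= j%:R `^ (- a) :> R.
Proof.
move=> j1; have /andP[a0 a1] := a01.
rewrite !powRN lef_pV2 ?posrE ?natpowR_gt0 //.
by apply: ge0_ler_powR; rewrite ?nnegrE ?ler0n ?ler_nat ?ltW.
Qed.

(** From [j + 1 <= 2 j] and [2^a <= 2]; this meets the ratio condition of [moreau_decr]. *)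
Lemma natpowRN_ratio (j : nat) : (1 <= j)%N ->
  j%:R `^ (- a) <= 2 * j.+1%:R `^ (- a) :> R.
Proof.
move=> j1; have /andP[a0 a1] := a01.
rewrite !powRN ler_pdivlMr ?natpowR_gt0 // mulrC ler_pdivrMr ?natpowR_gt0 //.
apply: (@le_trans _ _ ((2 * j%:R) `^ a)).
  have j2 : j.+1%:R <= 2 * j%:R :> R.
    by rewrite -natrM ler_nat mul2n -addnn -addn1 leq_add2l.
  by apply: ge0_ler_powR; rewrite ?nnegrE ?mulr_ge0 // ltW.
rewrite powRM // ler_wpM2r ?powR_ge0 //.
by apply: ler1_powR => //; rewrite ler1n.
Qed.

Lemma natpowRN_small (e : R) : 0 < e ->
  exists N : nat, forall j, (N <= j)%N -> j%:R `^ (- a) <= e.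
Proof.
move=> e0; have /andP[a0 a1] := a01.
pose b := e^-1 `^ a^-1.
have b0 : 0 < b by rewrite powR_gt0 // invr_gt0.
exists (Num.bound b) => j bj.
have bj' : b <= j%:R.
  by apply: le_trans (ltW (archi_boundP (ltW b0))) _; rewrite ler_nat.
have j0 : 0 < j%:R :> R by exact: lt_le_trans bj'.
rewrite powRN -[e]invrK lef_pV2 ?posrE ?powR_gt0 ?invr_gt0 //.
have : b `^ a <= j%:R `^ a.
  by apply: ge0_ler_powR; rewrite ?nnegrE ?(ltW a0) ?(ltW b0) ?(ltW j0).
by rewrite -powRrM mulVf ?gt_eqF // powRr1 // invr_ge0 ltW.
Qed.

End PowerSteps.

(** Telescoping would bound the partial sums of the harmonic series by the total descent. *)
Lemma harmonic_descent_unbounded (R : realType) (Phi : nat -> R) b N kappa :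
  0 < kappa ->
  (forall j, (N <= j)%N -> Phi j.+1 <= Phi j - kappa * j.+1%:R^-1) ->
  (forall j, (N <= j)%N -> b <= Phi j) -> False.
Proof.
move=> k0 dec lb; apply: (@dvg_harmonic R).
have bd (i : nat) : series (@harmonic R) (N + i)%N <=
    series (@harmonic R) N + kappa^-1 * (Phi N - Phi (N + i)%N).
  elim: i => [|i IH]; first by rewrite addn0 subrr mulr0 addr0.
  rewrite addnS seriesSr.
  have := dec (N + i)%N (leq_addr _ _).
  have : 0 < kappa^-1 by rewrite invr_gt0.
  have -> : harmonic (N + i)%N = kappa^-1 * (kappa * (N + i).+1%:R^-1) :> R.
    by rewrite /harmonic /= mulrA mulVf ?gt_eqF // mul1r.
  move=> ki0 h; have := ler_wpM2l (ltW ki0) h; move: IH.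
  move: (kappa * _) (kappa^-1) (Phi _) (Phi _) (Phi _) (series _ _) (series _ _).
  move=> r1 r2 r3 r4 r5 r6 r7; lra.
have hmono : nondecreasing_seq (series (@harmonic R)).
  apply/nondecreasing_seqP => i.
  by rewrite seriesSr lerDl /harmonic /= invr_ge0.
apply: nondecreasing_is_cvgn => //.
exists (series (@harmonic R) N + kappa^-1 * (Phi N - b)) => _ [i _ <-].
apply: le_trans (hmono _ _ (leq_addl N i)) _.
apply: le_trans (bd i) _.
rewrite lerD2l ler_pM2l ?invr_gt0 // lerD2l lerN2.
by rewrite lb // leq_addr.
Qed.

(** Every tail infimum is 0, so the sequence of tail infima is constant. *)
Lemma limn_einf_eq0 (R : realType) (u : nat -> \bar R) :
  (forall j, (0 <= u j)%E) ->
  (forall (e : R) N, 0 < e -> exists2 j, (N <= j)%N & (u j <= e%:E)%E) ->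
  limn_einf u = 0%E.
Proof.
move=> u0 us; rewrite limn_einf_lim.
suff -> : einfs u = cst 0%E by exact: lim_cst.
apply/funext => N; apply/le_anti/andP; split; last first.
  by apply: le_ereal_inf_tmp => _ [j _ <-].
apply/lee_addgt0Pr => e e0; rewrite add0e.
have [j Nj uj] := us e N e0.
by apply: le_trans uj; apply: ereal_inf_lbound; exists j.
Qed.

(** The assumed constant may have any sign; [|L| + 1] is positive and can be divided by. *)
Lemma elipschitz_pos (R : realType) n k (f : 'rV[R]_n -> 'rV[R]_k) :
  elipschitz f ->
  exists2 L, 0 < L & forall x y, enorm (f x - f y) <= L * enorm (x - y).
Proof.
move=> [L fL]; exists (`|L| + 1) => [|x y]; first by rewrite ltr_wpDl.
apply: le_trans (fL _ _) _; rewrite ler_wpM2r ?enorm_ge0 //.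
by apply: le_trans (ler_norm L) _; rewrite lerDl.
Qed.

Lemma elipschitz_real_pos (R : realType) n (f : 'rV[R]_n -> R) :
  elipschitz_real f ->
  exists2 L, 0 < L & forall x y, `|f x - f y| <= L * enorm (x - y).
Proof.
move=> [L fL]; exists (`|L| + 1) => [|x y]; first by rewrite ltr_wpDl.
apply: le_trans (fL _ _) _; rewrite ler_wpM2r ?enorm_ge0 //.
by apply: le_trans (ler_norm L) _; rewrite lerDl.
Qed.

Lemma deriv_lipschitz_pos (R : realType) n k (f : 'rV[R]_n -> 'rV[R]_k) :
  deriv_lipschitz f -> exists2 L, 0 < L & forall x y v,
    enorm ('d f x v - 'd f y v) <= L * enorm (x - y) * enorm v.
Proof.
move=> [L fL]; exists (`|L| + 1) => [|x y v]; first by rewrite ltr_wpDl.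
apply: le_trans (fL _ _ _) _; rewrite !ler_wpM2r ?enorm_ge0 //.
by apply: le_trans (ler_norm L) _; rewrite lerDl.
Qed.

(** * Convergence of the algorithm: step sizes, descent, and cluster points *)

Unset Implicit Arguments.

Theorem theorem2 (R : realType) (n k : nat)
  (S : 'rV[R]_n -> 'rV[R]_k) (g : 'rV[R]_k -> R) (eta : R)
  (C : set 'rV[R]_n)
  (x : nat -> 'rV[R]_n) (gam : nat -> R)
  (c rho gt alpha : R) :
  (forall y, differentiable S y) -> elipschitz S -> deriv_lipschitz S ->
  elipschitz_real g -> 0 < eta -> weakly_convex eta g ->
  C !=set0 -> closed C -> prox_regular C ->
  (exists xs, C xs /\ forall y, C y -> g (S xs) <= g (S y)) ->
  C (x 1%N) -> 0 < c < 2^-1 -> 0 < rho < 1 -> 0 < gt -> 1 <= alpha ->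
  let mu := fun j : nat => (2 * eta)^-1 * (j%:R `^ (- alpha^-1)) in
  let Fn := fun j : nat => fun y => moreau (mu j) g (S y) in
  let test := fun (j m : nat) (y : 'rV[R]_n) =>
    Fn j y <= Fn j (x j) - c * (rho ^+ m * gt)
                 * enorm ((rho ^+ m * gt)^-1 *: (x j - y)) ^+ 2 in
  (forall j : nat, (1 <= j)%N -> exists m : nat,
      gam j = rho ^+ m * gt /\
      in_proj C (x j - (rho ^+ m * gt) *: grad (Fn j) (x j)) (x j.+1) /\
      test j m (x j.+1) /\
      (forall m' : nat, (m' < m)%N -> exists y,
         in_proj C (x j - (rho ^+ m' * gt) *: grad (Fn j) (x j)) y /\
         ~ test j m' y)) ->
  let M := fun j : nat => Mstat (gam j) (fun y => (Fn j y)%:E) C (x j) in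
  limn_einf M = 0%E /\
  (forall sub : nat -> nat,
     (forall i j, (i < j)%N -> (sub i < sub j)%N) ->
     (forall l, (1 <= sub l)%N) ->
     (fun l => M (sub l)) @ \oo --> 0%E ->
     forall xs, C xs -> cluster ((fun l => x (sub l)) @ \oo) xs ->
       frechet_subdiff (fun y => (g (S y))%:E + iotaC C y)%E xs 0).
Proof.
move=> dS eS eDS eg eta0 gconv C0 cC [U [oU [CU Uuniq]]] [xmin [Cxmin minP]] Cx1.
move=> /andP[c0 c12] /andP[rho0 rho1] gt0 alpha1 mu Fn test alg M.
have [LS LS0 SL] := elipschitz_pos eS.
have [LD LD0 DSL] := deriv_lipschitz_pos eDS.
have [L L0 gL] := elipschitz_real_pos eg.
have a01 : 0 < alpha^-1 <= 1.
  have alpha0 : 0 < alpha by exact: lt_le_trans alpha1.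
  by rewrite invr_gt0 alpha0 /= invf_le1.
have eta2 : 0 < (2 * eta)^-1 by rewrite invr_gt0 mulr_gt0.
have mu0 j : (1 <= j)%N -> 0 < mu j.
  by move=> j1; rewrite mulr_gt0 // powR_gt0 // ltr0n.
have mule j : (1 <= j)%N -> mu j <= (2 * eta)^-1.
  by move=> j1; rewrite ler_piMr ?(ltW eta2) // natpowRN_le1.
have etamu j : (1 <= j)%N -> 2 * eta * mu j <= 1.
  by move=> j1; rewrite -ler_pdivlMl ?mulr_gt0 // mulr1 mule.
have mudecr j : (1 <= j)%N -> mu j.+1 <= mu j.
  by move=> j1; rewrite ler_pM2l // natpowRN_decr.
have muratio j : (1 <= j)%N -> mu j <= 2 * mu j.+1.
  by move=> j1; rewrite /mu mulrCA ler_pM2l // natpowRN_ratio.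
(* The shift to [j.+1] matches the terms of [harmonic]. *)
have muharm j : (1 <= j)%N -> (2 * eta)^-1 * j.+1%:R^-1 <= mu j.
  move=> j1; rewrite ler_pM2l //; apply: le_trans (natpowRN_ge a01 j1).
  by rewrite lef_pV2 ?posrE ?ltr0n // ler_nat.
have Cx j : (1 <= j)%N -> C (x j).
  by case: j => [//|[//|j]] _; have [m [_ [[]]]] := alg j.+1 isT.
pose K j := curvature L LS LD (mu j).
have K0 j : (1 <= j)%N -> 0 < K j by move=> /mu0; exact: curvature_gt0.
have Fexp j z : (1 <= j)%N -> forall y,
    `|Fn j y - Fn j z - dotv (grad (Fn j) z) (y - z)| <= K j * enorm (y - z) ^+ 2.
  move=> j1; exact: (smoothed_grad_expansion dS LS0 SL LD0 DSL L0 gL gconv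
    z (mu0 j j1) (etamu j j1)).
have gam0 j : (1 <= j)%N -> 0 < gam j <= gt.
  move=> j1; have [m [-> _]] := alg j j1.
  by rewrite mulr_gt0 ?exprn_gt0 //= ler_piMl ?(ltW gt0) // exprn_ile1 // ltW.
have [kappa kappa0 gamge] : exists2 kappa, 0 < kappa &
    forall j, (1 <= j)%N -> kappa * j.+1%:R^-1 <= gam j.
  pose Q := 2 * L * LD * (2 * eta)^-1 + 2^-1 * 3 * LS ^+ 2.
  have Q0 : 0 < Q by rewrite addr_gt0 // !mulr_gt0 // exprn_gt0.
  have KQ j : (1 <= j)%N -> K j * mu j <= Q.
    move=> j1; rewrite /K /curvature mulrDl lerD //.
      by rewrite ler_pM2l ?mulr_gt0 // mule.
    rewrite le_eqVlt; apply/orP; left; apply/eqP; field.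
    by rewrite gt_eqF // mu0.
  (* The first bound serves immediate acceptance, [gam j = gt]. The second serves [m > 0]: the
     rejected previous step exceeds [(1/2 - c) / K j], with [K j * mu j <= Q]. *)
  pose s := Num.min (gt * (2 * eta)) (rho * (2^-1 - c) / Q).
  have s0 : 0 < s.
    by rewrite lt_min !mulr_gt0 ?invr_gt0 // subr_gt0.
  exists (s * (2 * eta)^-1) => [|j j1]; first by rewrite mulr_gt0.
  apply: (@le_trans _ _ (s * mu j)); first by rewrite -mulrA ler_pM2l // muharm.
  have [m [-> [_ [_ fails]]]] := alg j j1.
  case: m fails => [_|m fails].
    rewrite expr0 mul1r; apply: (@le_trans _ _ (gt * (2 * eta) * mu j)).
      by rewrite ler_pM2r ?mu0 // ge_min lexx.
    by rewrite -mulrA ler_piMr ?etamu // ltW.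
  have [y [xy ntest]] := fails m (ltnSn m).
  have g0 : 0 < rho ^+ m * gt by rewrite mulr_gt0 ?exprn_gt0.
  have Kbig : 2^-1 - c < rho ^+ m * gt * K j.
    rewrite ltNge; apply/negP => gK; apply: ntest.
    exact: (projected_step_decrease (Fexp j (x j) j1) (Cx j j1) g0 gK xy).
  rewrite exprS -mulrA.
  apply: (@le_trans _ _ (rho * (2^-1 - c) / Q * mu j)).
    by rewrite ler_pM2r ?mu0 // ge_min lexx orbT.
  have muQ : (2^-1 - c) * mu j <= rho ^+ m * gt * Q.
    apply: (@le_trans _ _ (rho ^+ m * gt * K j * mu j)).
      by rewrite ler_wpM2r ?(ltW Kbig) // ltW // mu0.
    by rewrite -mulrA ler_pM2l // KQ.
  have -> : rho * (2^-1 - c) / Q * mu j = rho * ((2^-1 - c) * mu j / Q) by ring.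
  by rewrite ler_pM2l // ler_pdivrMr.
(* The only Fréchet subgradient of the smoothed objective is its gradient, so a near-minimizer in
   [M j] comes from a projected gradient step. *)
have MeP j (e : R) : (1 <= j)%N -> (M j < e%:E)%E -> exists2 a,
    in_proj C (x j - gam j *: grad (Fn j) (x j)) a &
    enorm ((gam j)^-1 *: (x j - a)) < e.
  move=> j1 /ereal_inf_lt[_ [a [v [vsub va]] <-]]; rewrite lte_fin => ae.
  exists a => //.
  by rewrite -(quadratic_frechet_subdiff_unique (Fexp j (x j) j1) (K0 j j1) vsub).
split.
  apply: limn_einf_eq0 => [j|e N e0].
    by apply: le_ereal_inf_tmp => _ [p _ <-]; rewrite lee_fin enorm_ge0.
  apply: contrapT => none.
  pose Phi j := Fn j (x j) + 4 * L ^+ 2 * mu j.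
  (* Taking [maxn N 1] keeps index 0, where the algorithm is not defined, out of the descent. *)
  apply: (@harmonic_descent_unbounded R Phi (g (S xmin)) (maxn N 1)
    (c * (kappa * e ^+ 2))) => [|j|j].
  - by rewrite !mulr_gt0 // exprn_gt0.
  - rewrite geq_max => /andP[Nj j1].
    have [m [gamE [xj1 [tst _]]]] := alg j j1.
    (* The accepted iterate itself competes in the infimum [M j]; a residual at most [e] would
       contradict [none]. *)
    have ej : e < enorm ((gam j)^-1 *: (x j - x j.+1)).
      rewrite ltNge; apply/negP => ej; apply: none; exists j => //.
      apply: (@le_trans _ _ (enorm ((gam j)^-1 *: (x j - x j.+1)))%:E);
        last by rewrite lee_fin.
      apply: ereal_inf_lbound; exists (x j.+1) => //.
      exists (grad (Fn j) (x j)); split; last by rewrite gamE.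
      exact: quadratic_frechet_subdiff (Fexp j (x j) j1) (K0 j j1).
    rewrite /test -gamE in tst.
    have hd := moreau_decr L0 gL (S (x j.+1)) (mu0 j.+1 isT) (mudecr j j1) (muratio j j1).
    have : c * (kappa * e ^+ 2) * j.+1%:R^-1 <=
        c * gam j * enorm ((gam j)^-1 *: (x j - x j.+1)) ^+ 2.
      have -> : c * (kappa * e ^+ 2) * j.+1%:R^-1 =
        c * (kappa * j.+1%:R^-1 * e ^+ 2) by ring.
      rewrite -[leRHS]mulrA ler_pM2l //; apply: ler_pM.
      + by rewrite mulr_ge0 // ltW.
      + by rewrite sqr_ge0.
      + exact: gamge.
      + by rewrite ler_pXn2r ?nnegrE ?enorm_ge0 // ltW.
    move: tst hd; rewrite /Phi /Fn.
    move: (c * gam j * _) (c * _ / _) (moreau _ _ _) (moreau _ _ _) (moreau _ _ _).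
    move=> b1 b2 b3 b4 b5; lra.
  - rewrite geq_max => /andP[Nj j1].
    have := moreau_ge L0 gL (S (x j)) (mu0 j j1).
    have := minP _ (Cx j j1).
    have : 0 <= L ^+ 2 * mu j by rewrite mulr_ge0 ?sqr_ge0 // ltW // mu0.
    rewrite /Phi /Fn; lra.
move=> sub subinc sub1 Mcvg xs Cxs xscl.
have /nbhs_enormP[dl dl0 dlU] : nbhs xs U by apply: open_nbhs_nbhs; split=> //; exact: CU.
(* If [a] is within [r] of [xs], the ball of radius [r] around [a] lies within [2 * r < dl] of [xs],
   hence in [U]. *)
pose r := dl / 3.
have r0 : 0 < r by rewrite divr_gt0.
pose Kst := stationarity_const L LS LD eta gt r.
have subge l : (l <= sub l)%N.
  by elim: l => [//|l IH]; apply: leq_ltn_trans IH _; exact: subinc.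
have main y : C y -> 0 < enorm (y - xs) ->
    g (S xs) - Kst * enorm (y - xs) ^+ 2 <= g (S y).
  move=> Cy D0.
  (* The bound [r / (1 + gt)] keeps the projected point [a] within [r] of [xs]; the other three are
     required by [stationarity_step]. *)
  pose e := Num.min (Num.min 1 (r / (1 + gt)))
                    (Num.min (enorm (y - xs)) (enorm (y - xs) ^+ 2)).
  have e0 : 0 < e.
    by rewrite !lt_min ltr01 D0 exprn_gt0 // divr_gt0 // addr_gt0.
  have [N1 muN] := natpowRN_small a01 (divr_gt0 e0 eta2).
  have [N2 _ MN] : \forall l \near \oo, (M (sub l) < e%:E)%E.
    apply: (Mcvg [set z | (z < e%:E)%E]).
    by apply: open_ereal_lt'; rewrite lte_fin.
  (* One index past both thresholds gives an iterate near [xs] with small smoothing parameter and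
     small residual. *)
  have /cluster_enormP/(_ e (maxn N1 N2) e0)[l] := xscl.
  rewrite geq_max => /andP[lN1 lN2] xle.
  have [a xa ae] := MeP (sub l) e (sub1 l) (MN l lN2).
  have axs : enorm (a - xs) <= r.
    have gl0 := gam0 _ (sub1 l); have /andP[gl1 gl2] := gl0.
    have xa' : enorm (x (sub l) - a) <= gt * e.
      have -> : x (sub l) - a = gam (sub l) *: ((gam (sub l))^-1 *: (x (sub l) - a)).
        by rewrite scalerA mulfV ?gt_eqF // scale1r.
      rewrite enormZ gtr0_norm //; apply: ler_pM; rewrite ?enorm_ge0 //; exact: ltW.
    have : (1 + gt) * e <= r.
      rewrite mulrC -ler_pdivlMr ?addr_gt0 //.
      by rewrite !ge_min lexx orbT.
    have := enormB_triangle a (x (sub l)) xs; rewrite (enormBC a (x (sub l))).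
    move: xa' xle; lra.
  apply: (@stationarity_step R n k S g L LS LD eta dS LS0 SL LD0 DSL L0 gL eta0 gconv
    C xs (x (sub l)) a y (gam (sub l)) gt (mu (sub l)) r e) => //.
  - move=> z p q za; apply: Uuniq; apply: dlU.
    have := enormB_triangle z a xs; move: za axs dl0; rewrite /r; lra.
  - exact: gam0.
  - rewrite mu0 //= /mu mulrC -ler_pdivlMr //; apply: muN.
    exact: leq_trans (subge l).
  - exact: etamu.
  - exact: ltW.
  - exact: ltW.
  - by rewrite !ge_min lexx.
  - by rewrite !ge_min lexx !orbT.
  - by rewrite !ge_min lexx !orbT.
have iC y : C y -> iotaC C y = 0%E by move=> Cy; rewrite /iotaC asboolT.
have Kst0 : 0 < `|Kst| + 1 by rewrite ltr_wpDl.
split=> [|d d0]; first by rewrite iC // adde0.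
(* Within this radius the quadratic loss [Kst |y - xs|^2] is at most [d |y - xs|]; outside [C] the
   indicator makes the inequality trivial. *)
exists (d / (`|Kst| + 1)); split=> [|y /andP[D0]]; first by rewrite divr_gt0.
rewrite ltr_pdivlMr // => Dd.
rewrite dotv0l sube0 (iC xs Cxs) adde0.
have [Cy|nCy] := pselect (C y); last first.
  by rewrite /iotaC asboolF // addey // addye // leey.
rewrite (iC y Cy) adde0 -EFinB lee_fin.
have := main y Cy D0.
have : Kst * enorm (y - xs) ^+ 2 <= d * enorm (y - xs).
  rewrite expr2 mulrA ler_wpM2r ?enorm_ge0 //.
  have := ler_wpM2r (ltW D0) (ler_norm Kst).
  move: Dd D0; rewrite mulrDr mulr1 (mulrC _ `|Kst|); lra.
lra.
Qed.
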